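(* Let $H$ be a non-abelian group generated by two elements $a,b$, and consider the wreath product $\Gamma=H\wr\mathbb{Z}^5$. Then for any $\varepsilon>0$ there exists a symmetric generating set $S$ of $\Gamma$ of size $160$ such that, if $X_n,Y_n,Z_n,W_n$ are independent simple random walks on $\Gamma$ where each step is uniform on $S$, $$\liminf_{n\to\infty}\Pr\left([[X_n,Y_n],[Z_n,W_n]]=1\right)\geq 1-\varepsilon.$$ In other words, $\Gamma$ satisfies the metabelian law $[[x,y],[z,w]]=1$ with probability $\geq 1-\varepsilon$ with respect to the simple random walk induced by $S$. In fact, the generating set $S$ can be taken as follows: letting $\pm e_i$ denote the $10$ standard generators of $\mathbb{Z}^5$, one takes $$S=\left\{s_1ms_2 : s_1,s_2\in\{(a^{\pm 1}\delta_{\underline{0}},\underline{0}),(b^{\pm 1}\delta_{ke_1},\underline{0})\},\ m\in\{(\underline{\mathrm{id}_H},\pm e_i)\}\right\}$$ for a large enough $k$.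
   Context: The wreath product $H\wr G$ is the semidirect product $\left(\bigoplus_{g\in G}H\right)\rtimes G$, where $G$ acts by $g\cdot(h_x)_{x\in G}=(h_{g^{-1}x})_{x\in G}$. Elements are written $(L,g)$ with $L\in\bigoplus_{G}H$ and $g\in G$. For $h\in H$, $g\in G$, $h\delta_g$ denotes the element of $\bigoplus_G H$ with value $h$ at $g$ and the identity of $H$ elsewhere; $\underline{\mathrm{id}_H}$ denotes the trivial element of $\bigoplus_G H$. The elements $\pm e_i$, $1\le i\le 5$, are the standard generators of $\mathbb{Z}^5$ and $\underline{0}$ is its identity. A simple random walk with steps uniform on $S$ is $R_0=1$, $R_{n+1}=R_nx_n$ with $x_n$ i.i.d. uniform on $S$. $[x,y]=xyx^{-1}y^{-1}$.
   Formalization: For the explicit S: that it generates is claimed only if no homomorphism H→Z/2 is nontrivial at both a and b (otherwise it never generates, e.g. H free), and that it has size 160 only if a²≠1 and b²≠1 (otherwise elements coincide). The existence of some S is proved for all H. *)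

(* Defs.v *)
From HB Require Import structures.
From mathcomp Require Import all_boot all_order all_algebra finmap.
From mathcomp Require Import all_classical all_reals all_analysis.

Set Implicit Arguments.
Unset Strict Implicit.
Unset Printing Implicit Defensive.

Import Order.TTheory GRing.Theory Num.Theory.

Local Open Scope classical_set_scope.
Local Open Scope fset_scope.
Local Open Scope group_scope.

Section Groups.
Variable G : groupType.

Definition is_subgroup (K : set G) : Prop :=
  [/\ K 1, (forall x y, K x -> K y -> K (x * y)) & (forall x, K x -> K x^-1)].

Definition generates (S : set G) : Prop := smallest is_subgroup S = setT.

Definition symmetric_fset (S : {fset G}) : Prop :=
  forall x, x \in S -> x^-1 \in S.

(* MathComp's [~ x, y] is x^-1 * y^-1 * x * y. *)
Definition commutator (x y : G) : G := x * y * x^-1 * y^-1.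

Definition metabelian_law (x y z w : G) : Prop :=
  commutator (commutator x y) (commutator z w) = 1.

End Groups.

(* The index group is written additively, so that the action
   (g . h)_x = h_(g^-1 x) reads h_(x - g). *)
Section Wreath.
Variables (H : groupType) (G : zmodType).

Record wreath : Type := Wreath { lamps : {fsfun G -> H with 1}; pos : G }.

(* Classical rather than structural equality, so that unification does not
   unfold the comparison of finitely supported functions. *)
HB.instance Definition _ := gen_eqMixin wreath.
HB.instance Definition _ := gen_choiceMixin wreath.

Implicit Types (L M : {fsfun G -> H with 1}) (g x : G) (u v w : wreath).

Definition wreath_one : wreath := Wreath [fsfun with 1] 0%R.

Definition wreath_mul u v : wreath :=
  Wreath
    [fsfun x in finsupp (lamps u)
                `|` [fset (y + pos u)%R | y in finsupp (lamps v)] =>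
       lamps u x * lamps v (x - pos u)%R]
    (pos u + pos v)%R.

Definition wreath_inv u : wreath :=
  Wreath
    [fsfun x in [fset (y - pos u)%R | y in finsupp (lamps u)] =>
       (lamps u (x + pos u)%R)^-1]
    (- pos u)%R.

Lemma wreath_mulE u v x :
  lamps (wreath_mul u v) x = lamps u x * lamps v (x - pos u)%R.
Proof.
rewrite fsfun_fun; case: ifP => // /negbT.
rewrite in_fsetU negb_or => /andP[ux vx].
rewrite (fsfun_dflt ux) mul1g fsfun_dflt //.
apply: contra vx => vx; apply/imfsetP => /=.
by exists (x - pos u)%R => //; rewrite subrK.
Qed.

Lemma wreath_invE u x : lamps (wreath_inv u) x = (lamps u (x + pos u)%R)^-1.
Proof.
rewrite fsfun_fun; case: ifP => // /negbT ux.
rewrite fsfun_dflt ?invg1 //; apply: contra ux => ux; apply/imfsetP => /=.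
by exists (x + pos u)%R => //; rewrite addrK.
Qed.

Lemma wreath_oneE x : lamps wreath_one x = 1.
Proof. by rewrite /= fsfun0E. Qed.

Lemma wreath_ext u v : lamps u =1 lamps v -> pos u = pos v -> u = v.
Proof.
by case: u v => [L g] [M h] /= LM ->; congr Wreath; apply/fsfunP.
Qed.

Let mulA : associative wreath_mul.
Proof.
move=> u v w; apply: wreath_ext => [x|]; last by rewrite /= addrA.
by rewrite !wreath_mulE mulgA /= opprD addrA.
Qed.

Let mul1 : left_id wreath_one wreath_mul.
Proof.
move=> u; apply: wreath_ext => [x|]; last by rewrite /= add0r.
by rewrite wreath_mulE wreath_oneE mul1g subr0.
Qed.

Let mulr1 : right_id wreath_one wreath_mul.
Proof.
move=> u; apply: wreath_ext => [x|]; last by rewrite /= addr0.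
by rewrite wreath_mulE wreath_oneE mulg1.
Qed.

Let mulV : left_inverse wreath_one wreath_inv wreath_mul.
Proof.
move=> u; apply: wreath_ext => [x|]; last by rewrite /= addNr.
by rewrite wreath_mulE wreath_invE wreath_oneE /= opprK mulVg.
Qed.

Let mulrV : right_inverse wreath_one wreath_inv wreath_mul.
Proof.
move=> u; apply: wreath_ext => [x|]; last by rewrite /= addrN.
by rewrite wreath_mulE wreath_invE wreath_oneE subrK mulgV.
Qed.

HB.instance Definition _ :=
  isGroup.Build wreath mulA mul1 mulr1 mulV mulrV.

Definition lamp (h : H) g : wreath := Wreath [fsfun x in [fset g] => h] 0%R.

Definition move g : wreath := Wreath [fsfun with 1] g.

End Wreath.

Section ExplicitGenerators.
Variables (H : groupType) (a b : H) (k : nat).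

Notation Z5 := ('rV[int]_5).
Notation Gamma := (wreath H Z5).

Definition std_gen (i : 'I_5) : Z5 := delta_mx 0%R i.

Definition switches : {fset Gamma} :=
  [fset lamp a 0%R; lamp a^-1 0%R;
        lamp b (std_gen ord0 *+ k)%R; lamp b^-1 (std_gen ord0 *+ k)%R].

Definition moves : {fset Gamma} :=
  [fset move H (std_gen i) | i in 'I_5]
  `|` [fset move H (- std_gen i)%R | i in 'I_5].

Definition switch_move_switch : {fset Gamma} :=
  [fset s * s2 | s in [fset s1 * m | s1 in switches, m in moves],
                 s2 in switches].

End ExplicitGenerators.

Section RandomWalks.
Context {R : realType} {d : measure_display} {T : measurableType d}.
Variables (P : probability T R) (G : groupType).

(* G carries the discrete sigma-algebra. *)
Definition iid_uniform (I : choiceType) (S : {fset G}) (x : I -> T -> G) :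
    Prop :=
  [/\ forall i (B : set G), measurable (x i @^-1` B),
      forall i s, s \in S -> P (x i @^-1` [set s]) = (#|` S|%:R^-1)%:E
    & forall (J : {fset I}) (B : I -> set G),
        P (\bigcap_(i in [set` J]) (x i @^-1` B i)) =
        (\prod_(i <- J) P (x i @^-1` B i))%E].

Fixpoint walk (x : nat -> T -> G) (n : nat) (t : T) : G :=
  if n is m.+1 then walk x m t * x m t else 1.

End RandomWalks.

(* One i.i.d. family indexed by (walk, time) encodes four independent simple
   random walks. *)
Definition metabelian_with_prob_ge (R : realType) (G : groupType)
    (S : {fset G}) (p : R) : Prop :=
  forall (d : measure_display) (T : measurableType d) (P : probability T R)
         (x : 'I_4 * nat -> T -> G),
    iid_uniform P S x ->
    let RW j := walk (fun i => x (inord j, i)) in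
    (p%:E <= limn_einf (fun n => P [set t |
       metabelian_law (RW 0%N n t) (RW 1%N n t) (RW 2%N n t) (RW 3%N n t)]))%E.

(* A homomorphism from H to Z/2 (bool under xor) that is nontrivial at both
   a and b; for instance, one exists when H is free on a and b. *)
Definition odd_at_both (H : groupType) (a b : H) : Prop :=
  exists phi : H -> bool,
    [/\ {morph phi : x y / x * y >-> x (+) y}, phi a & phi b].

(* With phi as above, (L, g) |-> \sum_x phi (L x) is a surjective homomorphism
   to Z/2 that kills every s1 * m * s2, as these contain two switches. *)
Section Parity.
Variables (H : groupType) (G : zmodType) (phi : H -> bool).
Hypothesis phiM : {morph phi : x y / x * y >-> x (+) y}.

Lemma phi1 : phi 1 = false.
Proof. by have := phiM 1 1; rewrite mulg1; case: (phi 1). Qed.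

Lemma phiV x : phi x^-1 = phi x.
Proof.
by have := phiM x x^-1; rewrite mulgV phi1; case: (phi x); case: (phi x^-1).
Qed.

Definition parity (u : wreath H G) : bool :=
  \big[addb/false]_(x <- finsupp (lamps u)) phi (lamps u x).

Lemma parityE (F : {fset G}) (u : wreath H G) : finsupp (lamps u) `<=` F ->
  parity u = \big[addb/false]_(x <- F) phi (lamps u x).
Proof.
move=> uF; rewrite /parity [LHS](big_fset_incl _ uF) // => x _ ux.
by rewrite fsfun_dflt ?phi1.
Qed.

Lemma parity1 : parity 1 = false.
Proof. by rewrite /parity big1 // => x _; rewrite wreath_oneE phi1. Qed.

Lemma parityM : {morph parity : u v / u * v >-> u (+) v}.
Proof.
move=> u v; pose Fv := [fset (y + pos u)%R | y in finsupp (lamps v)].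
rewrite (@parityE (finsupp (lamps u) `|` Fv)); last first.
  exact: finsupp_sub.
under eq_bigr do rewrite wreath_mulE phiM.
rewrite big_split /= -parityE ?fsubsetUl//; congr (_ (+) _).
rewrite -(@big_fset_incl _ _ _ _ Fv) ?fsubsetUr//=; last first.
  move=> x _ xF; rewrite fsfun_dflt ?phi1 //; apply: contra xF => xF.
  by apply/imfsetP => /=; exists (x - pos u)%R => //; rewrite subrK.
rewrite big_imfset /=; last by move=> x y _ _ /addIr.
by apply: eq_bigr => x _; rewrite addrK.
Qed.

Lemma parityV u : parity u^-1 = parity u.
Proof.
by have := parityM u u^-1; rewrite mulgV parity1;
  case: (parity u); case: (parity u^-1).
Qed.

Lemma parity_lamp h g : parity (lamp h g) = phi h.
Proof.
rewrite (@parityE [fset g]) ?finsupp_sub// big_seq_fset1.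
by rewrite fsfun_fun in_fset1 eqxx.
Qed.

Lemma parity_move g : parity (move H g) = false.
Proof. by rewrite /parity big1 // => x _; rewrite /= fsfun0E phi1. Qed.

End Parity.

Lemma switch_move_switch_not_generating (H : groupType) (a b : H) (k : nat) :
  odd_at_both a b -> ~ generates [set` switch_move_switch a b k].
Proof.
case=> phi [phiM phia phib] genS.
have phiV x : phi x^-1 = phi x by exact: phiV.
pose K : set (wreath H 'rV[int]_5) := [set u | parity phi u = false].
suff SK : (smallest (@is_subgroup _) [set` switch_move_switch a b k]
           `<=` K)%classic.
  have : K (lamp a 0%R) by apply: SK; rewrite (genS : _ = setT).
  by rewrite /K /= (parity_lamp phiM) phia.
apply: smallest_sub.
  split=> [|u v|u]; rewrite /K /=; first exact: parity1.
    by rewrite parityM // => -> ->.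
  by rewrite parityV.
have switch_odd s : s \in switches a b k -> parity phi s.
  rewrite /switches !in_fsetU !in_fset1.
  by move=> /orP[/orP[/orP[]|]|] /eqP ->;
    rewrite (parity_lamp phiM) ?phiV.
have move_even m : m \in moves H -> parity phi m = false.
  by rewrite /moves in_fsetU => /orP[] /imfsetP[i _ ->]; apply: parity_move.
move=> u /= /imfset2P[s /= /imfset2P[s1 /= s1S [m /= mM ->]] [s2 /= s2S ->]].
by rewrite /K /= !parityM // switch_odd // move_even // switch_odd.
Qed.

(* Main.v *)
Require Import Defs.
From HB Require Import structures.
From mathcomp Require Import all_boot all_order all_algebra finmap.
From mathcomp Require Import all_classical all_reals all_analysis.
From mathcomp Require Import zify ring lra.

Set Implicit Arguments.
Unset Strict Implicit.
Unset Printing Implicit Defensive.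

Import Order.TTheory GRing.Theory Num.Theory.

(** The lamp of [[X, Y]] at a site [x] is a product of letters [a^+-1] and
    [b^+-1], and a letter is contributed by each step taken at a position close
    to [x] (for [a]) or to [x - k e_1] (for [b]) by one of the four translated
    paths [X_i], [Y_n + X_i], [Y_i], [X_n + Y_i]. Hence [[X, Y]] and [[Z, W]]
    commute unless, at some site, a letter [a] of one of them meets a letter [b]
    of the other; then a point of a translated path of the first pair and a point
    of a translated path of the second pair differ by [+- k e_1] up to a bounded
    error ([metabelian_law_of_no_clash], [switch_move_clashes_in]). Letters of
    the same commutator are allowed to meet, which happens along the whole path.

    In dimension five such a difference is unlikely for large [k], uniformly in
    [n]. The paths of the two pairs are independent and symmetric, so the
    difference of two of their points with time indices [i] and [j] is the
    endpoint of a simple random walk of length [m >= i + j]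
    ([signed_sum_prob]). It equals a given [e] with probability at most
    [C m ^ (-5/2)], and with probability 0 if [m] is smaller than the first
    coordinate of [e]. The sum over [i] and [j] is bounded by a tail of the
    convergent series of [m * m ^ (-5/2)], which is of order [k ^ (-1/2)]
    ([sum_far_walk_prob_le]). The union bound thus holds for every [n], and the
    lower limit inherits it ([law_fails_prob]).

    The estimate of the walk is elementary. Once it is decided which steps are
    taken along which coordinate, the coordinates are independent
    one-dimensional walks, whose endpoint probabilities at time [j] are at most
    [(j + 1) ^ (-1/2)]. By Cauchy-Schwarz the square of the probability in
    dimension [d] is at most the multinomial mean of the product of the
    [1 / (j_l + 1)], and these denominators are absorbed into the multinomial
    coefficients ([lattice_walks_sqr]).

    The argument only uses that generators are of the form switch, move, switch
    and that their moves are uniform. The set [switch_move_switch] generates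
    unless there is a parity that it preserves, as the even words in [a] and [b]
    show ([even_words_a], [switch_move_switch_generates]). For the existence of a
    generating set of size 160 in all cases the set [spread_generators] avoids
    this parity: it contains the moves themselves, and has [a] switched at
    fourteen neighbouring sites in order to reach the required size. *)

Local Open Scope ring_scope.

(** * Counting lattice walks *)

Fixpoint line_walks (m : nat) (z : int) : nat :=
  if m is n.+1 then (line_walks n (z - 1) + line_walks n (z + 1))%N
  else (z == 0).

Lemma line_walks_gt (m : nat) (z : int) : (m < `|z|)%N -> line_walks m z = 0%N.
Proof.
elim: m z => [|m IHm] z /= mz; first by case: eqP => // z0; lia.
by rewrite !IHm //; lia.
Qed.

Lemma line_walks_parity (m : nat) (z : int) :
  (forall k : nat, z <> m%:Z - k%:Z *+ 2) -> line_walks m z = 0%N.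
Proof.
elim: m z => [|m IHm] z /= zP.
  by case: eqP => // z0; case: (zP 0%N); lia.
rewrite [X in (X + _)%N]IHm => [|k zk]; last by apply: (zP k); lia.
by rewrite IHm // => k zk; apply: (zP k.+1); lia.
Qed.

Lemma line_walks_bin (m k : nat) : line_walks m (m%:Z - k%:Z *+ 2) = 'C(m, k).
Proof.
elim: m k => [|m IHm] [|k] /=.
- by [].
- by rewrite bin0n.
- have -> : m.+1%:Z - 0%N%:Z *+ 2 - 1 = m%:Z - 0%N%:Z *+ 2 by lia.
  by rewrite IHm line_walks_gt ?bin0 ?addn0; lia.
- have -> : m.+1%:Z - k.+1%:Z *+ 2 - 1 = m%:Z - k.+1%:Z *+ 2 by lia.
  have -> : m.+1%:Z - k.+1%:Z *+ 2 + 1 = m%:Z - k%:Z *+ 2 by lia.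
  by rewrite !IHm binS.
Qed.

Lemma leq_bin_half (m k : nat) : ('C(m, k) <= 'C(m, m./2))%N.
Proof.
have low j : (j <= m./2)%N -> ('C(m, m./2 - j) <= 'C(m, m./2))%N.
  elim: j => [|j IHj] jm; first by rewrite subn0.
  apply: leq_trans (IHj (ltnW jm)); set i := (m./2 - j.+1)%N.
  have -> : (m./2 - j)%N = i.+1 by rewrite /i; lia.
  have := mul_bin_left m i; have : (i.+1 <= m - i)%N by rewrite /i; lia.
  by case: (leqP 'C(m, i) 'C(m, i.+1)) => //; nia.
have [km|mk] := leqP k m./2; first
  by have := low (m./2 - k)%N; rewrite subKn //; apply; lia.
have [km|mk'] := leqP k m; last by rewrite bin_small.
rewrite -bin_sub //; have := low (m./2 - (m - k))%N; rewrite subKn; last by lia.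
by apply; lia.
Qed.

(** The factor [2j + 1] makes the induction close: from [j] to [j + 1] the
    left side is multiplied by [16 (2j + 1) (2j + 3) / (2j + 2) ^ 2], which is
    at most 16. *)
Lemma central_bin_sqr (j : nat) : ('C(j.*2, j) ^ 2 * (j.*2).+1 <= 16 ^ j)%N.
Proof.
elim: j => [|j IHj] //.
have E : (j.+1 * 'C((j.+1).*2, j.+1) = 2 * (j.*2).+1 * 'C(j.*2, j))%N.
  have e1 := mul_bin_diag (j.*2.+2) j.
  have e2 := mul_bin_down (j.*2.+1) j.
  have -> : (j.+1.*2 = j.*2.+2)%N by lia.
  have e3 : ((j.*2.+1 - j) = j.+1)%N by lia.
  rewrite e3 /= in e2 *. rewrite /= in e1.
  have e4 : (j.+1 * 'C(j.*2.+2, j.+1) = j.+1 * (2 * 'C(j.*2.+1, j)))%N.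
    by rewrite -e1; lia.
  move/eqP: e4; rewrite eqn_mul2l /= => /eqP ->; lia.
rewrite (expnS 16) doubleS; rewrite doubleS in E.
set c := 'C(j.*2, j) in E IHj *; set c' := 'C(_, j.+1) in E *.
have : ((j.+1 * c') ^ 2 * (j.*2.+3) <= j.+1 ^ 2 * (16 * 16 ^ j))%N.
  rewrite E; set d := (j.*2) in IHj *.
  have -> : (j.+1 ^ 2 * (16 * 16 ^ j) = 4 * (d.+2 ^ 2) * 16 ^ j)%N by rewrite /d; nia.
  apply: leq_trans (leq_mul (leqnn _) IHj). 
  have -> : ((2 * d.+1 * c) ^ 2 * d.+3 = 4 * (d.+1 * d.+3) * (c ^ 2 * d.+1))%N by nia.
  by rewrite leq_mul2r; apply/orP; right; nia.
by rewrite expnMn -mulnA leq_pmul2l.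
Qed.

(** The largest binomial coefficient is the central one; an odd length reduces
    to the next even one by [C(2j + 2, j + 1) = 2 C(2j + 1, j)]. *)
Lemma line_walks_sqr (m : nat) (z : int) : 
  (line_walks m z ^ 2 * m.+1 <= 4 ^ m)%N.
Proof.
have bin_sqr k : ('C(m, k) ^ 2 * m.+1 <= 4 ^ m)%N.
  apply: (@leq_trans ('C(m, m./2) ^ 2 * m.+1)).
    by rewrite leq_mul2r leq_exp2r // leq_bin_half orbT.
  have [mo|me] := boolP (odd m); last first.
    have mE : m = (m./2).*2 by rewrite halfK (negbTE me) subn0.
    have := central_bin_sqr m./2.
    by rewrite -mE -[16%N]/(4 ^ 2)%N -expnM mul2n -mE.
  have mE : m = (m./2).*2.+1 by have := odd_double_half m; rewrite mo; lia.
  set j := m./2 in mE *.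
  have := central_bin_sqr j.+1.
  have -> : ('C(j.+1.*2, j.+1) = 2 * 'C(m, j))%N.
    rewrite doubleS binS -mE -(bin_sub (m := j)); last by lia.
    by rewrite (_ : m - j = j.+1)%N; lia.
  have -> : (16 ^ j.+1 = 4 * 4 ^ m)%N.
    by rewrite -[16%N]/(4 ^ 2)%N -expnM -expnS mE; congr (_ ^ _)%N; lia.
  rewrite expnMn -mulnA leq_pmul2l // => H; apply: leq_trans H.
  by rewrite leq_mul2l; apply/orP; right; lia.
have [[k ->]|nk] := pselect (exists k : nat, z = m%:Z - k%:Z *+ 2).
  by rewrite line_walks_bin.
rewrite line_walks_parity // => k zk; apply: nk; by exists k.
Qed.

(** The coefficients of a product of exponential generating functions. *)
Definition binconv (R : pzSemiRingType) (f g : nat -> R) (m : nat) : R :=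
  \sum_(j < m.+1) (f j * g (m - j)%N) *+ 'C(m, j).

(** The Leibniz rule, differentiation being the shift of coefficients. *)
Lemma binconvS (R : pzSemiRingType) (f g : nat -> R) (m : nat) :
  binconv f g m.+1 =
  binconv (fun j => f j.+1) g m + binconv f (fun j => g j.+1) m.
Proof.
rewrite /binconv big_ord_recl /= bin0 mulr1n subn0.
under eq_bigr => j _ do rewrite /bump leq0n add1n subSS binS mulrnDr.
rewrite big_split /= addrA [RHS]addrC; congr (_ + _).
transitivity (\sum_(j < m.+2) (f j * g (m.+1 - j)%N) *+ 'C(m, j)).
  by rewrite [RHS]big_ord_recl bin0 mulr1n subn0.
rewrite big_ord_recr /= bin_small // mulr0n addr0.
by apply: eq_bigr => j _; rewrite subSn // -ltnS.
Qed.

(** Cauchy-Schwarz, with the squares and products replaced by bounds, so that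
    no square root has to be taken. *)
Lemma sum_sqr_le (R : realDomainType) (I : Type) (r : seq I) (x p q : I -> R) :
  (forall i, 0 <= p i) -> (forall i, 0 <= q i) ->
  (forall i, x i ^+ 2 <= p i * q i) ->
  (\sum_(i <- r) x i) ^+ 2 <= (\sum_(i <- r) p i) * (\sum_(i <- r) q i).
Proof.
move=> p0 q0 xpq; elim: r => [|i r IHr]; first by rewrite !big_nil expr0n mul0r.
rewrite !big_cons; move: (p0 i) (q0 i) (xpq i) IHr.
have: 0 <= \sum_(j <- r) p j by apply: sumr_ge0.
have: 0 <= \sum_(j <- r) q j by apply: sumr_ge0.
set Q := \sum_(j <- r) q j; set P := \sum_(j <- r) p j.
set X := \sum_(j <- r) x j.
move: (p i) (q i) (x i) P Q X => u v z P Q X Q0 P0 u0 v0 zuv XPQ.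
suff zX : (z * X) *+ 2 <= P * v + u * Q by rewrite sqrrD; nra.
have [zX0|zX0] := leP (z * X) 0; first by nra.
rewrite -(@ler_pXn2r _ 2) // ?nnegrE; [|by nra|by nra].
have : (z * X) ^+ 2 <= (u * v) * (P * Q) by rewrite exprMn ler_pM // sqr_ge0.
have := sqr_ge0 (P * v - u * Q).
by nra.
Qed.

Lemma binconv_sqr_le (R : realDomainType) (f g a b c d : nat -> R) (m : nat) :
  (forall j, 0 <= a j) -> (forall j, 0 <= b j) ->
  (forall j, 0 <= c j) -> (forall j, 0 <= d j) ->
  (forall j, f j ^+ 2 <= a j * b j) -> (forall j, g j ^+ 2 <= c j * d j) ->
  binconv f g m ^+ 2 <= binconv a c m * binconv b d m.
Proof.
move=> a0 b0 c0 d0 fab gcd; apply: sum_sqr_le => j.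
- by rewrite mulrn_wge0 // mulr_ge0.
- by rewrite mulrn_wge0 // mulr_ge0.
rewrite -[f j * _ *+ _]mulr_natr -[a j * _ *+ _]mulr_natr.
rewrite -[b j * _ *+ _]mulr_natr exprMn [leRHS]mulrACA -expr2.
by rewrite ler_wpM2r ?sqr_ge0 // exprMn [leRHS]mulrACA ler_pM ?sqr_ge0.
Qed.

(** The number of nearest-neighbour walks of length [m] from 0 to [v], one
    coordinate at a time: the binomial coefficient in the convolution chooses
    which of the steps are taken along the first coordinate. *)
Fixpoint lattice_walks (R : pzSemiRingType) (d m : nat) : 'rV[int]_d -> R :=
  if d is e.+1 then fun v =>
    binconv (fun j => (line_walks j (v 0 0))%:R)
            (fun i => lattice_walks R i (col' 0 v)) m
  else fun _ => (m == 0%N)%:R.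

Lemma eq_binconv (R : pzSemiRingType) (f f' g g' : nat -> R) (m : nat) :
  f =1 f' -> g =1 g' -> binconv f g m = binconv f' g' m.
Proof. by move=> ff gg; apply: eq_bigr => j _; rewrite ff gg. Qed.

Lemma binconvDl (R : pzSemiRingType) (f f' g : nat -> R) (m : nat) :
  binconv (fun j => f j + f' j) g m = binconv f g m + binconv f' g m.
Proof. by rewrite -big_split; apply: eq_bigr => j _; rewrite mulrDl mulrnDl. Qed.

Lemma binconv_sumr (R : pzSemiRingType) (I : Type) (r : seq I) (f : nat -> R)
    (g : I -> nat -> R) (m : nat) :
  binconv f (fun j => \sum_(i <- r) g i j) m = \sum_(i <- r) binconv f (g i) m.
Proof.
rewrite exchange_big; apply: eq_bigr => j _.
by rewrite mulr_sumr sumrMnl.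
Qed.

(** By the Leibniz rule a further step is a further step along one of the
    coordinates. *)
Lemma lattice_walksS (R : pzSemiRingType) (d m : nat) (v : 'rV[int]_d) :
  lattice_walks R m.+1 v =
  \sum_(i < d) (lattice_walks R m (v - delta_mx 0 i)
                + lattice_walks R m (v + delta_mx 0 i)).
Proof.
elim: d m v => [|d IHd] m v; first by rewrite big_ord0.
rewrite big_ord_recl /= binconvS; congr (_ + _).
  under eq_binconv => [j|i]; [rewrite natrD; over|over|].
  rewrite binconvDl; congr (_ + _); apply: eq_binconv => [j|i].
  - by rewrite !mxE !eqxx.
  - by congr lattice_walks; apply/rowP => l; rewrite !mxE /= subr0.
  - by rewrite !mxE !eqxx.
  - by congr lattice_walks; apply/rowP => l; rewrite !mxE /= addr0.
under eq_binconv => [j|i]; [over|rewrite IHd; over|].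
rewrite binconv_sumr; apply: eq_bigr => i _.
rewrite -[RHS]/(binconv _ _ _ + binconv _ _ _).
transitivity (binconv (fun j => (line_walks j (v 0 0))%:R)
   (fun j => lattice_walks R j (col' 0 v - delta_mx 0 i)) m +
   binconv (fun j => (line_walks j (v 0 0))%:R)
   (fun j => lattice_walks R j (col' 0 v + delta_mx 0 i)) m).
  by rewrite -big_split; apply: eq_bigr => j _; rewrite mulrDr mulrnDl.
congr (_ + _); apply: eq_binconv => j.
- by rewrite !mxE /= subr0.
- by congr lattice_walks; apply/rowP => l; rewrite !mxE /=.
- by rewrite !mxE /= addr0.
- by congr lattice_walks; apply/rowP => l; rewrite !mxE /=.
Qed.

Lemma lattice_walks_far (R : pzSemiRingType) (d m : nat) (v : 'rV[int]_d.+1) :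
  (m < `|v 0%R 0%R|)%N -> lattice_walks R m v = 0.
Proof.
move=> mv /=; rewrite /binconv big1 // => j _.
rewrite line_walks_gt ?mul0r ?mul0rn //.
by apply: leq_ltn_trans mv; rewrite -ltnS.
Qed.

Lemma lattice_walks_ge0 (R : numDomainType) (d m : nat) (v : 'rV[int]_d) :
  0 <= lattice_walks R m v.
Proof.
elim: d m v => [|d IHd] m v /=; first exact: ler0n.
by apply: sumr_ge0 => j _; rewrite mulrn_wge0 // mulr_ge0.
Qed.

(** Split the one-dimensional bound on the square as [1 * (4 ^ j / (j + 1))]
    and apply Cauchy-Schwarz to the convolution. The factors 1 convolve to the
    total number of choices of coordinates. In the other factor the
    denominators are absorbed by the binomial coefficient, [C(m, j) (m - j)! /
    ((j + 1) (m - j + d)!) = m! / (m + d + 1)! * C(m + d + 1, j + 1)], and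
    what remains is part of the binomial expansion of [(d + 1) ^ (m + d + 1)].
    *)
Lemma lattice_walks_sqr (R : realFieldType) (d m : nat) (v : 'rV[int]_d) :
  lattice_walks R m v ^+ 2 <=
  d%:R ^+ m * (4 ^+ m * d%:R ^+ (m + d) * m`!%:R / (m + d)`!%:R).
Proof.
elim: d m v => [|d IHd] m v.
  rewrite /= addn0; case: m => [|m] /=.
    by rewrite ?fact0 !expr0 expr1n !mul1r ?invr1.
  by rewrite expr0n /= exprS !mul0r.
pose b j : R := 4 ^+ j / j.+1%:R.
pose c i : R := 4 ^+ i * d%:R ^+ (i + d) * i`!%:R / (i + d)`!%:R.
have c0 i : 0 <= c i by rewrite /c !mulr_ge0 ?invr_ge0 ?exprn_ge0.
have b0 j : 0 <= b j by rewrite /b mulr_ge0 ?invr_ge0 ?exprn_ge0.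
apply: (@le_trans _ _
  (binconv (fun=> 1) (fun i => d%:R ^+ i) m * binconv b c m)).
  apply: binconv_sqr_le => [j|j|j|j|j|i].
  - exact: ler01.
  - exact: b0.
  - by rewrite exprn_ge0.
  - exact: c0.
  - rewrite mul1r /b ler_pdivlMr ?ltr0Sn //.
    by rewrite -!natrX -natrM ler_nat line_walks_sqr.
  - exact: IHd.
apply: ler_pM.
- by apply: sumr_ge0 => j _; rewrite mulrn_wge0 // mul1r exprn_ge0.
- by apply: sumr_ge0 => j _; rewrite mulrn_wge0 // mulr_ge0.
- rewrite -natr1 exprDn; apply: ler_sum => j _.
  by rewrite mul1r expr1n mulr1.
rewrite /binconv.
have term (j : 'I_m.+1) : (b j * c (m - j)%N) *+ 'C(m, j) =
    4 ^+ m * m`!%:R / (m + d.+1)`!%:R *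
    (d%:R ^+ ((m + d.+1) - j.+1) *+ 'C(m + d.+1, j.+1)).
  have jm : (j <= m)%N by rewrite -ltnS.
  have -> : (m + d.+1 - j.+1 = m - j + d)%N by lia.
  rewrite /b /c -(mulr_natr _ 'C(m, j)) -[X in _ = _ * X]mulr_natr.
  have <- : 4 ^+ j * 4 ^+ (m - j) = 4 ^+ m :> R by rewrite -exprD subnKC.
  have f0 n : (n`!%:R : R) != 0 by rewrite pnatr_eq0 -lt0n fact_gt0.
  have /(congr1 (fun n => n%:R : R)) := bin_fact jm.
  have /(congr1 (fun n => n%:R : R)) := @bin_fact (m + d.+1) j.+1 ltac:(lia).
  have -> : (m + d.+1 - j.+1 = m - j + d)%N by lia.
  rewrite factS !natrM => <- <-.
  field.
  rewrite !f0 nat1r !pnatr_eq0 -!lt0n bin_gt0 /=.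
  by lia.
rewrite (eq_bigr _ (fun j _ => term j)) -mulr_sumr.
have -> : 4 ^+ m * d.+1%:R ^+ (m + d.+1) * m`!%:R / (m + d.+1)`!%:R =
    4 ^+ m * m`!%:R / (m + d.+1)`!%:R * d.+1%:R ^+ (m + d.+1) :> R by ring.
rewrite ler_wpM2l ?mulr_ge0 ?invr_ge0 ?exprn_ge0 //.
rewrite -[d.+1%:R]natr1 exprDn [leRHS]big_ord_recl /=.
rewrite -[leLHS]add0r lerD // ?mulrn_wge0 ?mulr_ge0 ?exprn_ge0 //.
rewrite addnS -addSn big_split_ord /= -[leLHS]addr0 lerD //.
  apply: ler_sum => j _; rewrite expr1n mulr1 /bump leq0n add1n; exact: lexx.
by apply: sumr_ge0 => j _; rewrite expr1n mulr1 mulrn_wge0 ?exprn_ge0.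
Qed.

Lemma expn_mul_fact_leq (m d : nat) : (m.+1 ^ d * m`! <= (m + d)`!)%N.
Proof.
elim: d => [|d IHd]; first by rewrite addn0 mul1n.
by rewrite addnS factS expnS -mulnA leq_mul // ltnS leq_addr.
Qed.

Lemma walk_prob_sqr (R : realFieldType) (d m : nat) (v : 'rV[int]_d) :
  (lattice_walks R m v / d.*2%:R ^+ m) ^+ 2 <= d%:R ^+ d / m.+1%:R ^+ d.
Proof.
case: d v => [|d] v.
  rewrite /= !expr0 divr1; case: m => [|m] /=; first by rewrite expr0 divr1 expr1n.
  by rewrite mul0r expr0n /=.
rewrite expr_div_n ler_pdivrMr ?exprn_gt0 ?ltr0n //.
apply: le_trans (lattice_walks_sqr _ _ _) _.
rewrite exprD mulrA mulrA -muln2 natrM.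
have -> : d.+1%:R ^+ m * (4 ^+ m * (d.+1%:R ^+ m * d.+1%:R ^+ d.+1)) =
    d.+1%:R ^+ d.+1 * ((d.+1%:R * 2) ^+ m) ^+ 2 :> R.
  have -> : 4 = 2 ^+ 2 :> R by rewrite -natrX.
  rewrite exprAC exprMn; move: (_ ^+ m) (_ ^+ m) (_ ^+ d.+1) => x y z; ring.
set p := _ ^+ 2; have p0 : 0 <= p by apply: sqr_ge0.
rewrite [leRHS]mulrAC -[leLHS]mulrA; apply: ler_wpM2l.
  by apply: mulr_ge0 => //; apply: exprn_ge0.
rewrite ler_pdivrMr ?ltr0n ?fact_gt0 // ler_pdivlMl ?exprn_gt0 ?ltr0n //.
by rewrite -natrX -natrM ler_nat expn_mul_fact_leq.
Qed.

Definition rsqrt (R : rcfType) (x : nat) : R := (Num.sqrt x%:R)^-1.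

Lemma rsqrt_ge0 (R : rcfType) (x : nat) : 0 <= rsqrt R x.
Proof. by rewrite invr_ge0 sqrtr_ge0. Qed.

Lemma rsqrt_gt0 (R : rcfType) (x : nat) : 0 < rsqrt R x.+1.
Proof. by rewrite invr_gt0 sqrtr_gt0. Qed.

Lemma rsqrt_sqr (R : rcfType) (x : nat) : rsqrt R x ^+ 2 = x%:R^-1.
Proof. by rewrite exprVn sqr_sqrtr. Qed.

Lemma rsqrt_le (R : rcfType) (x y : nat) :
  (x.+1 <= y)%N -> rsqrt R y <= rsqrt R x.+1.
Proof.
case: y => // y xy; rewrite lef_pV2 ?posrE ?sqrtr_gt0 //.
by rewrite ler_sqrt ?ler_nat.
Qed.

(** Both bounds come from [u ^ 2 - w ^ 2 = u ^ 2 * w ^ 2], which gives [u * w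
    ^ 2 <= 2 * (u - w)]. *)
Lemma rsqrt_telescope (R : rcfType) (x : nat) :
  let u := rsqrt R x.+1 in let w := rsqrt R x.+2 in
  w ^+ 3 <= 2 * (u - w) /\ w ^+ 5 <= 2 * (u ^+ 3 - w ^+ 3).
Proof.
move=> u w.
have u0 : 0 < u by apply: rsqrt_gt0.
have w0 : 0 < w by apply: rsqrt_gt0.
have wu : w <= u by apply: rsqrt_le.
have E : u ^+ 2 - w ^+ 2 = u ^+ 2 * w ^+ 2.
  rewrite /u /w !rsqrt_sqr -[x.+2%:R]natr1; field.
  by rewrite nat1r natr1 !pnatr_eq0.
have H : u * w ^+ 2 <= 2 * (u - w).
  rewrite -(ler_pM2l u0).
  have -> : u * (u * w ^+ 2) = u ^+ 2 - w ^+ 2 by rewrite E; ring.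
  by nra.
split; first by apply: le_trans H; rewrite exprS ler_wpM2r ?sqr_ge0.
apply: (@le_trans _ _ (u * w ^+ 2 * u ^+ 2)).
  rewrite (exprS w 4) -[X in w * X]/(w ^+ (2 + 2)) exprD mulrA.
  rewrite ler_pM ?mulr_ge0 ?sqr_ge0 // ?(ltW w0) //.
    by rewrite ler_wpM2r ?sqr_ge0.
  by rewrite lerXn2r // nnegrE ltW.
apply: (@le_trans _ _ (2 * (u - w) * (u ^+ 2 + u * w + w ^+ 2))).
  have uw0 := mulr_ge0 (ltW u0) (ltW w0); have w20 := sqr_ge0 w.
  by apply: ler_pM => //; [exact: mulr_ge0 (ltW u0) w20|exact: sqr_ge0|lra].
by rewrite le_eqVlt; apply/orP; left; apply/eqP; ring.
Qed.

Lemma sum_rsqrt3 (R : rcfType) (n K : nat) :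
  \sum_(i < n) rsqrt R (i + K.+2) ^+ 3 <= 2 * rsqrt R K.+1.
Proof.
suff : \sum_(i < n) rsqrt R (i + K.+2) ^+ 3 <=
    2 * (rsqrt R K.+1 - rsqrt R (n + K.+1)).
  by move=> H; apply: le_trans H _; have := rsqrt_ge0 R (n + K.+1); lra.
elim: n => [|n IHn]; first by rewrite big_ord0 subrr mulr0.
rewrite big_ord_recr /=; have [] := rsqrt_telescope R (n + K).
by rewrite -!addnS addSn -addnS; lra.
Qed.

Lemma sum_rsqrt5 (R : rcfType) (n K : nat) :
  \sum_(i < n) rsqrt R (i + K.+2) ^+ 5 <= 2 * rsqrt R K.+1 ^+ 3.
Proof.
suff : \sum_(i < n) rsqrt R (i + K.+2) ^+ 5 <=
    2 * (rsqrt R K.+1 ^+ 3 - rsqrt R (n + K.+1) ^+ 3).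
  move=> H; apply: le_trans H _.
  by have := exprn_ge0 3 (rsqrt_ge0 R (n + K.+1)); lra.
elim: n => [|n IHn]; first by rewrite big_ord0 subrr mulr0.
rewrite big_ord_recr /=; have [_] := rsqrt_telescope R (n + K).
by rewrite -!addnS addSn -addnS; lra.
Qed.

(** A walk of length [m <= K] does not reach [v], and for longer ones [m + 1]
    is at least [(m + K + 2) / 2]. This makes the estimate small in [K] for
    all lengths at once, short ones included. *)
Lemma far_walk_prob_le (R : rcfType) (K m : nat) (v : 'rV[int]_5) :
  (K < `|v 0%R 0%R|)%N ->
  lattice_walks R m v / 10 ^+ m <= Num.sqrt (10 ^+ 5) * rsqrt R (m + K.+2) ^+ 5.
Proof.
move=> Kv.
have rhs0 : 0 <= Num.sqrt (10 ^+ 5) * rsqrt R (m + K.+2) ^+ 5.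
  by rewrite mulr_ge0 ?sqrtr_ge0 ?exprn_ge0 ?rsqrt_ge0.
have [mv|vm] := ltnP m `|v 0 0|; first by rewrite lattice_walks_far ?mul0r.
rewrite -(@ler_pXn2r _ 2) ?nnegrE ?divr_ge0 ?lattice_walks_ge0 ?exprn_ge0 //.
apply: le_trans (walk_prob_sqr _ _ _) _.
rewrite exprMn sqr_sqrtr ?exprn_ge0 // exprAC rsqrt_sqr.
rewrite -expr_div_n -exprMn lerXn2r ?nnegrE ?divr_ge0 ?mulr_ge0 ?invr_ge0 //.
rewrite ler_pdivlMr ?ltr0n; last by lia.
rewrite mulrAC ler_pdivrMr ?ltr0n // -!natrM ler_nat; lia.
Qed.

(** Summing over two time indices costs two powers of the length, and [5 / 2 >
    2] leaves a convergent tail: this is where the dimension enters. *)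
Lemma sum_far_walk_prob_le (R : rcfType) (K n : nat) (c : nat -> nat -> nat)
    (v : 'rV[int]_5) :
  (K.+1 < `|v 0%R 0%R|)%N -> (forall i j, (i + j <= c i j)%N) ->
  \sum_(i < n) \sum_(j < n) lattice_walks R (c i j) v / 10 ^+ c i j <=
  4 * Num.sqrt (10 ^+ 5) * rsqrt R K.+1.
Proof.
move=> Kv cij; set C := Num.sqrt _.
have C0 : 0 <= C by apply: sqrtr_ge0.
apply: (@le_trans _ _ (\sum_(i < n) C * (2 * rsqrt R (i + K.+2) ^+ 3))).
  apply: ler_sum => i _.
  apply: (@le_trans _ _ (\sum_(j < n) C * rsqrt R (j + (i + K.+1).+2) ^+ 5)).
    apply: ler_sum => j _; apply: le_trans (far_walk_prob_le _ _ Kv) _.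
    rewrite ler_wpM2l // lerXn2r ?nnegrE ?rsqrt_ge0 // !addnS rsqrt_le //.
    by rewrite !ltnS addnA leq_add2r addnC.
  by rewrite -mulr_sumr ler_wpM2l // [(i + K.+2)%N]addnS; apply: sum_rsqrt5.
rewrite -mulr_sumr -mulr_sumr mulrCA mulrA -mulrA.
rewrite [leRHS](_ : _ = 2 * (C * (2 * rsqrt R K.+1))); last by ring.
by rewrite !ler_wpM2l // ?sum_rsqrt3.
Qed.

(** * Subgroups and generation *)

Section GroupGeneration.
Local Open Scope group_scope.
Variable G : groupType.
Implicit Types (K S : set G) (x y z : G).

Lemma generates_ind S K : generates S -> is_subgroup K -> (S `<=` K)%classic ->
  forall x, K x.
Proof.
move=> genS subK SK x; have : [set: G]%classic x by [].
by rewrite -(genS : _ = _); apply: smallest_sub.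
Qed.

Lemma is_subgroup_centralizer x : is_subgroup [set y | commute x y]%classic.
Proof.
split=> [|y z|y] /=; [exact: commute1|exact: commuteM|exact: commuteV].
Qed.

Lemma generates_commute S : generates S ->
  (forall x y, S x -> S y -> commute x y) -> forall x y, commute x y.
Proof.
move=> genS commS x y; move: y.
apply: (generates_ind genS (is_subgroup_centralizer x)) => y Sy /=.
apply: commute_sym; move: x.
by apply: (generates_ind genS (is_subgroup_centralizer y)) => x Sx; apply: commS.
Qed.

Lemma is_subgroup_smallest S : is_subgroup (smallest (@is_subgroup G) S).
Proof.
split=> [K [[]]//|x y Sx Sy K KS|x Sx K KS]; have [[K1 KM KV] _] := KS.
- by apply: KM; [apply: Sx|apply: Sy].
- by apply: KV; apply: Sx.
Qed.

Lemma mulg_swap x y p q : commute p y -> x * p * (y * q) = x * y * (p * q).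
Proof. by move=> py; rewrite mulgA -[x * p * y]mulgA py !mulgA. Qed.

Lemma mulg_conj x y z : x * (y * z) * x^-1 = x * y * x^-1 * (x * z * x^-1).
Proof. by rewrite !mulgA mulgVK. Qed.

Lemma is_subgroup_conj K x :
  is_subgroup K -> is_subgroup [set y | K (x * y * x^-1)]%classic.
Proof.
move=> [K1 KM KV]; split=> [|y z Ky Kz|y Ky] /=.
- by rewrite mulg1 mulgV.
- by rewrite mulg_conj; apply: KM.
- by have := KV _ Ky; rewrite !invgM invgK mulgA.
Qed.

(** The exponent of [c] only matters modulo 2, as [c] commutes with the image
    of [f] and [c * c] lies in [K]. *)
Lemma is_subgroup_twisted (G' : groupType) (f : G' -> G) K c :
  is_subgroup K -> f 1 = 1 -> {morph f : x y / x * y} ->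
  (forall x : G', commute c (f x)) -> K (c * c) ->
  is_subgroup [set x : G' | K (f x) \/ K (f x * c)]%classic.
Proof.
move=> [K1 KM KV] f1 fM cf Kcc.
have fV (x : G') : f x^-1 = (f x)^-1.
  by apply/esym/mulg1_eq; rewrite -fM mulgV.
split=> [|x y [Kx|Kx] [Ky|Ky]|x [Kx|Kx]] /=.
- by left; rewrite f1.
- by left; rewrite fM; apply: KM.
- by right; rewrite fM -mulgA; apply: KM.
- right; have := KM _ _ Kx Ky.
  by rewrite -mulgA cf mulgA -fM.
- left; have := KM _ _ (KM _ _ Kx Ky) (KV _ Kcc).
  by rewrite mulg_swap // mulgK -fM.
- by left; rewrite fV; apply: KV.
- right; have := KM _ _ (KV _ Kx) Kcc.
  by rewrite -cf invgM mulgA mulgVK fV.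
Qed.

Lemma generated_countable (s : seq G) :
  generates [set` s]%classic -> countable [set: G].
Proof.
move=> genS.
pose letter i := nth 1 (s ++ map (fun x => x^-1) s) i.
pose word w := foldr (fun i x => letter i * x) 1 w.
have word_cat v w : word (v ++ w) = word v * word w.
  by elim: v => [|i v IHv] /=; rewrite ?mul1g // IHv mulgA.
have letterV i : exists j, letter j = (letter i)^-1.
  rewrite /letter; have [ltis|leis] := ltnP i (size s).
    exists (size s + i)%N; rewrite !nth_cat ltis -ltn_subRL subnn ltn0 addKn.
    by rewrite (nth_map 1).
  have [lti|gei] := ltnP (i - size s) (size s).
    exists (i - size s)%N; rewrite !nth_cat lti ltnNge leis /= (nth_map 1) //.
    by rewrite invgK.
  by exists i; rewrite nth_default ?invg1 // size_cat size_map -leq_subRL.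
have wordV w : exists v, word v = (word w)^-1.
  elim: w => [|i w [v vE]]; first by exists [::]; rewrite /= invg1.
  have [j jE] := letterV i; exists (v ++ [:: j]).
  by rewrite word_cat /= mulg1 jE vE invgM.
apply: (@sub_countable _ _ _ (range word)); last first.
  by apply: card_le_trans (card_image_le _ _) _; apply: countableP.
apply: subset_card_le => x _.
apply: (generates_ind genS (K := range word)) => [|y ys].
  split=> [|_ _ [v _ <-] [w _ <-]|_ [w _ <-]].
  - by exists [::].
  - by exists (v ++ w) => //; rewrite word_cat.
  - by have [v <-] := wordV w; exists v.
exists [:: index y s] => //=; rewrite mulg1 /letter nth_cat index_mem ys.
exact: nth_index.
Qed.

End GroupGeneration.

(** * Calculus in the wreath product *)

Section WreathCalculus.
Local Open Scope group_scope.
Variables (H : groupType) (G : zmodType).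
Implicit Types (u v : wreath H G) (h : H) (g x : G).

Lemma posM u v : pos (u * v) = (pos u + pos v)%R. Proof. by []. Qed.

Lemma posV u : pos u^-1 = (- pos u)%R. Proof. by []. Qed.

Lemma lampsM u v x : lamps (u * v) x = lamps u x * lamps v (x - pos u)%R.
Proof. exact: wreath_mulE. Qed.

Lemma lampsV u x : lamps u^-1 x = (lamps u (x + pos u)%R)^-1.
Proof. exact: wreath_invE. Qed.

Lemma lamps1 x : lamps (1 : wreath H G) x = 1.
Proof. exact: wreath_oneE. Qed.

Lemma lamps_lamp h g x : lamps (lamp h g) x = if x == g then h else 1.
Proof. by rewrite /= fsfun_fun in_fset1. Qed.

Lemma lamps_move g x : lamps (move H g) x = 1.
Proof. by rewrite /= fsfun0E. Qed.

Lemma lampM h h' g : lamp h g * lamp h' g = lamp (h * h') g.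
Proof.
apply: wreath_ext => [x|]; last by rewrite /= addr0.
by rewrite lampsM !lamps_lamp /= subr0; case: eqP; rewrite ?mulg1.
Qed.

Lemma lamp1 g : lamp (1 : H) g = 1.
Proof.
by apply: wreath_ext => // x; rewrite lamps_lamp lamps1; case: eqP.
Qed.

Lemma lampV h g : (lamp h g)^-1 = lamp h^-1 g.
Proof. by apply: mulg1_eq; rewrite lampM mulgV lamp1. Qed.

End WreathCalculus.

Section WreathGeneration.
Local Open Scope group_scope.
Variables (H : groupType) (G : zmodType).
Implicit Types (K : set (wreath H G)) (h : H) (g x : G).

Lemma moveD g g' : move H (g + g')%R = move H g * move H g'.
Proof. by apply: wreath_ext => // x; rewrite lampsM !lamps_move mulg1. Qed.

Lemma moveN g : move H (- g)%R = (move H g)^-1.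
Proof. by apply: wreath_ext => // x; rewrite lampsV !lamps_move invg1. Qed.

Lemma move0 : move H (0 : G)%R = 1.
Proof. by []. Qed.

Lemma move_lamp g h x : move H g * lamp h x * move H (- g)%R = lamp h (x + g)%R.
Proof.
apply: wreath_ext => [y|]; last by rewrite /= addr0 addrN.
by rewrite !lampsM !lamps_move mulg1 mul1g !lamps_lamp subr_eq.
Qed.

Lemma lamp_commute h h' x x' : x != x' -> commute (lamp h x) (lamp h' x').
Proof.
move=> xx'; apply: wreath_ext => [y|]; last by rewrite /= addr0.
rewrite !lampsM /= !subr0 -/(lamps (lamp h x) y) -/(lamps (lamp h' x') y).
rewrite !lamps_lamp; case: eqP => [->|_]; last by rewrite mulg1 mul1g.
by rewrite (negPf xx') mulg1 mul1g.
Qed.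

Lemma wreath_decomp (u : wreath H G) :
  u = (\prod_(x <- finsupp (lamps u)) lamp (lamps u x) x) * move H (pos u).
Proof.
have prodE (s : seq G) : uniq s ->
    let p := \prod_(x <- s) lamp (lamps u x) x in
    pos p = 0%R /\ forall y, lamps p y = if y \in s then lamps u y else 1.
  elim: s => [_|x s IHs /= /andP[xs /IHs[posp lampsp]]].
    by rewrite big_nil; split=> // y; rewrite lamps1.
  rewrite big_cons posM posp addr0; split=> // y.
  rewrite lampsM lampsp lamps_lamp subr0 inE.
  by case: eqP => [->|_]; rewrite ?(negPf xs) ?mulg1 ?mul1g.
have [posp lampsp] := prodE _ (fset_uniq (finsupp (lamps u))).
apply: wreath_ext => [y|]; last by rewrite posM posp add0r.
rewrite lampsM lamps_move mulg1 lampsp; case: ifPn => // yu.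
by rewrite fsfun_dflt.
Qed.

Lemma wreath_total K : is_subgroup K ->
  (forall h x, K (lamp h x)) -> (forall g, K (move H g)) -> forall u, K u.
Proof.
move=> [K1 KM _] Klamp Kmove u; rewrite [u]wreath_decomp; apply: (KM) => //.
exact: big_ind.
Qed.

End WreathGeneration.

(** * Even words and generation by switch-move-switch *)

Section EvenWords.
Local Open Scope group_scope.
Variables (H : groupType) (a b : H).

Definition letters : set H := [set a; a^-1; b; b^-1]%classic.

Definition even_words : set H :=
  smallest (@is_subgroup H) [set x * y | x in letters & y in letters]%classic.

Lemma lettersV x : letters x -> letters x^-1.
Proof.
move=> [[[->|->]|->]|->]; rewrite ?invgK.
- by left; left; right.
- by left; left; left.
- by right.
- by left; right.
Qed.

Lemma even_words_pair x y : letters x -> letters y -> even_words (x * y).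
Proof. by move=> lx ly K [_ SK]; apply: SK; exists x => //; exists y. Qed.

Lemma even_words_conj x h : letters x -> even_words h ->
  even_words (x * h * x^-1).
Proof.
have [E1 EM EV] : is_subgroup even_words by apply: is_subgroup_smallest.
move=> lx Eh; apply: (Eh [set g | even_words (x * g * x^-1)]%classic).
split=> [|_ [y ly [z lz <-]]]; first exact/is_subgroup_conj/is_subgroup_smallest.
rewrite /=; have -> : x * (y * z) * x^-1 = (x * y) * (z * x^-1) by rewrite !mulgA.
by apply: EM; apply: even_words_pair => //; apply: lettersV.
Qed.

(** Otherwise the even words form a subgroup of index two containing neither
    letter, and the indicator function of its complement is a homomorphism to
    Z/2 that is odd at both. *)
Lemma even_words_a : generates [set a; b]%classic -> ~ odd_at_both a b ->
  even_words a.
Proof.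
move=> genab nodd; apply: contrapT => nEa; apply: nodd.
have [E1 EM EV] : is_subgroup even_words by apply: is_subgroup_smallest.
have la : letters a by left; left; left.
have lb : letters b by left; right.
have Eaa : even_words (a * a) by apply: even_words_pair.
have Eba : even_words (b * a) by apply: even_words_pair.
have Ecj h : even_words h -> even_words (a^-1 * h * a).
  by move=> Eh; have := even_words_conj (lettersV la) Eh; rewrite invgK.
have half h : even_words h \/ even_words (h * a).
  move: h; apply: (generates_ind genab) => [|h [->|->]]; [|by right|by right].
  split=> [|h g [Eh|Eh] [Eg|Eg]|h [Eh|Eh]] /=.
  - by left.
  - by left; apply: EM.
  - by right; rewrite -mulgA; apply: EM.
  - right; have := EM _ _ Eh (Ecj _ Eg).
    by rewrite !mulgA mulgK.
  - left; have := EM _ _ Eh (EM _ _ (Ecj _ Eg) (EV _ Eaa)).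
    by rewrite invgM !mulgA !mulgK.
  - by left; apply: EV.
  - right; have := EM _ _ (even_words_conj la (EV _ Eh)) Eaa.
    by rewrite invgM !mulgA mulgV mul1g mulgVK.
have Elr h : even_words (h * a) -> even_words (a^-1 * h).
  by move=> Eh; have := EM _ _ (Ecj _ Eh) (EV _ Eaa); rewrite invgM !mulgA !mulgK.
exists (fun h => ~~ `[<even_words h>]); split; last first.
- apply/asboolPn => Eb; apply: nEa.
  by have := EM _ _ (EV _ Eb) Eba; rewrite mulKg.
- exact/asboolPn.
move=> x y; case: (asboolP (even_words x)) => Ex /=.
  congr negb; apply/asboolP/asboolP => [Exy|Ey]; last exact: EM.
  by have := EM _ _ (EV _ Ex) Exy; rewrite mulKg.
case: (asboolP (even_words y)) => Ey /=.
  apply/asboolPn => Exy; apply: Ex.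
  by have := EM _ _ Exy (EV _ Ey); rewrite mulgK.
apply/negbTE; rewrite negbK; apply/asboolP.
have [//|Exa] := half x; have [//|Eya] := half y.
have := EM _ _ Exa (Elr _ Eya); by rewrite mulgA mulgK.
Qed.

End EvenWords.

Section LatticeMoves.
Local Open Scope group_scope.
Variable H : groupType.
Implicit Types (K : set (wreath H 'rV[int]_5)).

Lemma move_lattice K : is_subgroup K -> (forall i, K (move H (std_gen i))) ->
  forall g, K (move H g).
Proof.
move=> [K1 KM KV] Kgen g; rewrite (row_sum_delta g).
have KD x y : K (move H x) -> K (move H y) -> K (move H (x + y)%R).
  by rewrite moveD; apply: KM.
apply: (@big_ind _ (fun x => K (move H x))) => // i _.
have Kn (n : nat) : K (move H (n%:Z *: std_gen i)%R).
  rewrite -natz scaler_nat; elim: n => [|n IHn]; first by rewrite mulr0n move0.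
  by rewrite mulrS; apply: KD.
case: (g 0%R i) => n; first exact: Kn.
by rewrite NegzE scaleNr moveN; apply: KV.
Qed.

Lemma lattice_lamps_total (a b : H) K : is_subgroup K ->
  generates [set a; b]%classic ->
  (forall x, K (lamp a x)) -> (forall x, K (lamp b x)) ->
  (forall i, K (move H (std_gen i))) -> forall u, K u.
Proof.
move=> subK genab Ka Kb Km; apply: wreath_total => //; last exact: move_lattice.
have [K1 KM KV] := subK.
move=> h x; move: h.
apply: (generates_ind genab (K := [set h | K (lamp h x)]%classic)).
  split=> [|h h' Kh Kh'|h Kh] /=; first by rewrite lamp1.
    by rewrite -lampM; apply: KM.
  by rewrite -lampV; apply: KV.
by move=> h [] ->.
Qed.

Lemma wreath_countable (a b : H) : generates [set a; b]%classic ->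
  countable [set: wreath H 'rV[int]_5].
Proof.
move=> genab.
apply: (@generated_countable _ ([:: lamp a 0%R; lamp b 0%R] ++
  [seq move H (std_gen i) | i <- enum 'I_5])).
apply/seteqP; split=> // u _ K [subK genK].
have [K1 KM KV] := subK.
have Kmove i : K (move H (std_gen i)).
  apply: genK => /=; rewrite !in_cons; apply/orP; right; apply/orP; right.
  by apply/mapP; exists i; rewrite ?mem_enum.
have Klamp h x : K (lamp h 0%R) -> K (lamp h x).
  move=> Kh; have := move_lamp x h 0%R; rewrite add0r => <-.
  by apply: (KM); [apply: (KM) => //|]; apply: move_lattice.
apply: (lattice_lamps_total subK genab) => // x; apply: Klamp; apply: genK => /=.
- by rewrite inE eqxx.
- by rewrite !inE eqxx orbT.
Qed.

End LatticeMoves.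

Section ExplicitGeneration.
Local Open Scope group_scope.
Variables (H : groupType) (a b : H) (k : nat).

Notation far := (std_gen ord0 *+ k)%R.

Lemma switches_cases s : s \in switches a b k <->
  (s = lamp a 0%R \/ s = lamp a^-1 0%R) \/
  (s = lamp b far \/ s = lamp b^-1 far).
Proof.
rewrite /switches !in_fsetU !in_fset1; split.
  by move=> /orP[/orP[/orP[]|]|] /eqP ->; tauto.
by move=> [[] ->|[] ->]; rewrite eqxx ?orbT.
Qed.

Lemma switchesV s : s \in switches a b k -> s^-1 \in switches a b k.
Proof.
move=> /switches_cases[[]|[]] ->; rewrite lampV ?invgK; apply/switches_cases.
all: tauto.
Qed.

Lemma moves_cases m : m \in moves H <->
  exists i, m = move H (std_gen i) \/ m = move H (- std_gen i)%R.
Proof.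
rewrite /moves in_fsetU; split.
  by move=> /orP[] /imfsetP[i _ ->]; exists i; [left|right].
by move=> [i [] ->]; apply/orP; [left|right]; apply/imfsetP; exists i.
Qed.

Lemma movesV m : m \in moves H -> m^-1 \in moves H.
Proof.
move=> /moves_cases[i [] ->]; rewrite -moveN ?opprK; apply/moves_cases; exists i;
by [left|right].
Qed.

Lemma switch_move_switchP s : reflect
  (exists s1 m s2, [/\ s1 \in switches a b k, m \in moves H,
     s2 \in switches a b k & s = s1 * m * s2])
  (s \in switch_move_switch a b k).
Proof.
apply: (iffP idP) => /=.
  move=> /imfset2P[_ /= /imfset2P[s1 /= s1S [m /= mM ->]] [s2 s2S ->]].
  by exists s1, m, s2.
move=> [s1 [m [s2 [s1S mM s2S ->]]]].
apply/imfset2P; exists (s1 * m) => /=; last by exists s2.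
by apply/imfset2P; exists s1 => //; exists m.
Qed.

Lemma switch_move_switch_symmetric : symmetric_fset (switch_move_switch a b k).
Proof.
move=> _ /switch_move_switchP[s1 [m [s2 [s1S mM s2S ->]]]].
apply/switch_move_switchP; exists s2^-1, m^-1, s1^-1.
split; [exact: switchesV|exact: movesV|exact: switchesV|].
by rewrite !invgM mulgA.
Qed.

Lemma far_coord : far 0%R 0%R = k.
Proof. by rewrite mulmxnE /std_gen !mxE /= -[RHS]natz. Qed.

(** After conjugation by the switch [a] at 0, the subgroup generated becomes a
    subgroup [L] containing all moves and all products of two switches, hence
    their translates. Modulo [L], a letter [a] at [x] cancels against a [b] at
    [x + far], and a letter [b] at [x] against an [a] at [x - far], so an even
    word placed at [x] is trivial modulo [L] up to the correction [c x], which
    has order two there. Since [a] is itself an even word, either [a] at [x]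
    or [a] at [x - far] lies in [L]. *)
Lemma switch_move_switch_generates : (0 < k)%N ->
  generates [set a; b]%classic -> ~ odd_at_both a b ->
  generates [set` switch_move_switch a b k]%classic.
Proof.
move=> k_gt0 genab nodd; rewrite /generates; set K := smallest _ _.
have [K1 KM KV] : is_subgroup K by apply: is_subgroup_smallest.
have KS s1 m s2 : s1 \in switches a b k -> m \in moves H ->
    s2 \in switches a b k -> K (s1 * m * s2).
  move=> s1S mM s2S L [_ SL]; apply: SL; apply/switch_move_switchP.
  by exists s1, m, s2.
have m0M : move H (std_gen 0) \in moves H by apply/moves_cases; exists 0%R; left.
have Kpair s s' : s \in switches a b k -> s' \in switches a b k -> K (s * s').
  move=> sS s'S.
  have := KM _ _ (KS _ _ _ sS m0M sS) (KV _ (KS _ _ _ (switchesV s'S) m0M sS)).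
  by rewrite !invgM invgK !mulgA mulgK mulgK.
pose s0 : wreath H 'rV[int]_5 := lamp a 0%R.
have s0S : s0 \in switches a b k by apply/switches_cases; left; left.
pose L : set (wreath H 'rV[int]_5) := [set u | K (s0 * u * s0^-1)]%classic.
have subL : is_subgroup L by apply: is_subgroup_conj.
have Lmove i : L (move H (std_gen i)).
  apply: KS; rewrite ?switchesV //; apply/moves_cases; exists i; by left.
suff Lall u : L u.
  apply/seteqP; split=> // u _; have := Lall (s0^-1 * u * s0).
  by rewrite /L /= !mulgA mulgV mul1g mulgK.
have [L1 LM LV] := subL.
have Lpair s s' : s \in switches a b k -> s' \in switches a b k -> L (s * s').
  move=> sS s'S; rewrite /L /=; have -> : s0 * (s * s') * s0^-1 =
    (s0 * s) * (s' * s0^-1) by rewrite !mulgA.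
  by apply: KM; apply: Kpair; rewrite ?switchesV.
have Lshift g h h' x x' : L (lamp h x * lamp h' x') ->
    L (lamp h (x + g)%R * lamp h' (x' + g)%R).
  move=> Lhh; have Lg := move_lattice subL Lmove g.
  have := LM _ _ (LM _ _ Lg Lhh) (LV _ Lg).
  by rewrite mulg_conj -moveN !move_lamp.
have LAA h h' x : h = a \/ h = a^-1 -> h' = a \/ h' = a^-1 ->
    L (lamp h x * lamp h' x).
  move=> hA h'A; rewrite -[x]add0r; apply: Lshift; apply: Lpair;
    apply/switches_cases; left.
  - by case: hA => ->; [left|right].
  - by case: h'A => ->; [left|right].
have LBB h h' x : h = b \/ h = b^-1 -> h' = b \/ h' = b^-1 ->
    L (lamp h x * lamp h' x).
  move=> hB h'B; have -> : x = (far + (x - far))%R by rewrite addrC subrK.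
  apply: Lshift; apply: Lpair; apply/switches_cases; right.
  - by case: hB => ->; [left|right].
  - by case: h'B => ->; [left|right].
have LAB h h' x : h = a \/ h = a^-1 -> h' = b \/ h' = b^-1 ->
    L (lamp h x * lamp h' (x + far)%R).
  move=> hA h'B; rewrite -{1}[x]add0r [(x + far)%R]addrC.
  apply: Lshift; apply: Lpair; apply/switches_cases.
  - by left; case: hA => ->; [left|right].
  - by right; case: h'B => ->; [left|right].
have far0 : far != 0%R.
  apply/eqP => /(congr1 (fun v : 'rV_5 => v 0%R 0%R)); rewrite far_coord mxE.
  by lia.
have far20 : (far + far != 0)%R.
  apply/eqP => /(congr1 (fun v : 'rV_5 => v 0%R 0%R)).
  by rewrite mxE far_coord mxE; lia.
have xfar x : (x != x + far)%R by rewrite -subr_eq0 opprD addNKr oppr_eq0.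
have farx x : (x != x - far)%R by rewrite -subr_eq0 opprD opprK addNKr.
have farfar x : (x + far != x - far)%R.
  by rewrite -subr_eq0 opprD opprK addrACA subrr add0r.
(* The lamps left over when a letter a and a letter b are placed at x. *)
pose c x := lamp b (x + far)%R * lamp a (x - far)%R.
have cc x h : commute (c x) (lamp h x).
  by apply: commute_sym; apply: commuteM; apply: lamp_commute.
have Lcc x : L (c x * c x).
  rewrite /c mulgA -[_ * _ * lamp b _]mulgA -[lamp a _ * lamp b _]lamp_commute //.
  by rewrite mulgA -mulgA; apply: LM; [apply: LBB|apply: LAA]; left.
pose T x : set H := [set h | L (lamp h x) \/ L (lamp h x * c x)]%classic.
have subT x : is_subgroup (T x).
  apply: is_subgroup_twisted => //; first exact: lamp1.
  by move=> h h'; rewrite lampM.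
have evenT x : (even_words a b `<=` T x)%classic.
  apply: smallest_sub => // _ [h lh [h' lh' <-]].
  have hAB : (h = a \/ h = a^-1) \/ (h = b \/ h = b^-1).
    by case: lh => [[[->|->]|->]|->]; tauto.
  have hAB' : (h' = a \/ h' = a^-1) \/ (h' = b \/ h' = b^-1).
    by case: lh' => [[[->|->]|->]|->]; tauto.
  have LA g : g = a \/ g = a^-1 -> L (lamp g x * lamp b (x + far)%R).
    by move=> gA; apply: LAB => //; left.
  have LB g : g = b \/ g = b^-1 -> L (lamp g x * lamp a (x - far)%R).
    move=> gB; rewrite lamp_commute // -{2}[x](subrK far).
    by apply: LAB => //; left.
  case: hAB hAB' => hx [] h'x.
  - by left; rewrite -lampM; apply: LAA.
  - right; rewrite -lampM /c -(mulg_swap (lamp h x) (lamp a (x - far)%R)).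
      by apply: LM; [apply: LA|apply: LB].
    by apply: lamp_commute; rewrite eq_sym.
  - right; rewrite -lampM /c (lamp_commute b a (farfar x)).
    rewrite -(mulg_swap (lamp h x) (lamp b (x + far)%R)).
      by apply: LM; [apply: LB|apply: LA].
    by apply: lamp_commute; rewrite eq_sym.
  - by left; rewrite -lampM; apply: LBB.
have La x : L (lamp a x).
  case: (evenT (x + far)%R _ (even_words_a genab nodd)) => [La|].
    have := Lshift (- far)%R a 1 (x + far)%R 0%R.
    by rewrite !lamp1 !mulg1 addrK; apply.
  rewrite /c mulgA => Lac.
  have Lab := LAB a b (x + far)%R (or_introl erefl) (or_introl erefl).
  have := LM _ _ (LV _ Lab) Lac.
  by rewrite mulKg addrK.
apply: (lattice_lamps_total subL genab) => // x.
have := LM _ _ (LV _ (La (x - far)%R))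
  (LAB a b (x - far)%R (or_introl erefl) (or_introl erefl)).
by rewrite mulKg subrK.
Qed.

End ExplicitGeneration.

(** * The metabelian law along four walks *)

Section WalkLamps.
Local Open Scope group_scope.
Context {d : measure_display} {T : measurableType d}.
Variables (H : groupType) (G : zmodType).
Implicit Types (x y z w : nat -> T -> wreath H G) (h : H) (g : G) (t : T).

Lemma pos_walk x n t : pos (walk x n t) = (\sum_(i < n) pos (x i t))%R.
Proof.
elim: n => [|n IHn]; first by rewrite big_ord0.
by rewrite big_ord_recr [walk _ _ _]/= posM IHn.
Qed.

Lemma walk_lamps_commute x n t h g :
  (forall i, (i < n)%N -> commute h (lamps (x i t) (g - pos (walk x i t))%R)) ->
  commute h (lamps (walk x n t) g).
Proof.
elim: n => [_|n IHn comm]; first by rewrite [walk _ _ _]/= lamps1; apply: commute1.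
rewrite [walk _ _ _]/= lampsM; apply: commuteM; last exact: comm.
by apply: IHn => i ni; apply: comm; apply: ltnW.
Qed.

Lemma commutator_lamps_commute (u v : wreath H G) h g :
  commute h (lamps u g) -> commute h (lamps v (g - pos u)%R) ->
  commute h (lamps u (g - pos v)%R) -> commute h (lamps v g) ->
  commute h (lamps (commutator u v) g).
Proof.
move=> hug hvu huv hvg; rewrite /commutator !lampsM !lampsV !posM !posV.
have -> : (g - (pos u + pos v) + pos u = g - pos v)%R by rewrite opprD addrA addrAC subrK.
have -> : (g - (pos u + pos v - pos u) + pos v = g)%R.
  by rewrite [(pos u + _)%R]addrC addrK subrK.
by do ![apply: commuteM|apply: commuteV|assumption].
Qed.

Lemma pos_commutator (u v : wreath H G) : pos (commutator u v) = 0%R.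
Proof. by rewrite /commutator !posM !posV addrAC addrK subrr. Qed.

Lemma commutator_eq1 (u v : wreath H G) : pos u = 0%R -> pos v = 0%R ->
  (forall g, commute (lamps u g) (lamps v g)) -> commutator u v = 1.
Proof.
move=> u0 v0 comm; have uv : u * v = v * u.
  apply: wreath_ext => [g|]; last by rewrite !posM u0 v0.
  by rewrite !lampsM u0 v0 !subr0 comm.
by rewrite /commutator uv mulgK mulgV.
Qed.

(** The lamp of the commutator of [X_n] and [Y_n] at a site [g] is composed of
    the lamp of [X_n] at [g] and at [g - pos Y_n] and the lamp of [Y_n] at [g]
    and at [g - pos X_n]. These four lamps were switched from the sites [X_i],
    [Y_n + X_i], [Y_i] and [X_n + Y_i]; a pair of times encodes each of them.
    *)
Definition visit_times (n i : nat) : seq (nat * nat) :=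
  [:: (i, 0); (n, i); (i, n); (0, i)]%N.

Definition visit x y t (c : nat * nat) : G :=
  (pos (walk x c.1 t) + pos (walk y c.2 t))%R.

Lemma commutator_walk_commute (S : {fset wreath H G}) x y n t h g :
  (forall i, (i < n)%N -> x i t \in S /\ y i t \in S) ->
  (forall i c s, (i < n)%N -> c \in visit_times n i -> s \in S ->
     commute h (lamps s (g - visit x y t c)%R)) ->
  commute h (lamps (commutator (walk x n t) (walk y n t)) g).
Proof.
move=> xyS comm; have commx i c (ni : (i < n)%N) (ci : c \in visit_times n i) :=
  comm i c _ ni ci (proj1 (xyS i ni)).
have commy i c (ni : (i < n)%N) (ci : c \in visit_times n i) :=
  comm i c _ ni ci (proj2 (xyS i ni)).
apply: commutator_lamps_commute; apply: walk_lamps_commute => i ni.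
- have := commx i (i, 0)%N ni; rewrite /visit /= addr0; apply.
  by rewrite !inE eqxx.
- have := commy i (n, i) ni; rewrite /visit /= opprD addrA; apply.
  by rewrite !inE eqxx !orbT.
- have := commx i (i, n) ni.
  rewrite /visit /= opprD [(- _ - _)%R]addrC addrA; apply.
  by rewrite !inE eqxx !orbT.
- have := commy i (0, i)%N ni; rewrite /visit /= add0r; apply.
  by rewrite !inE eqxx !orbT.
Qed.

(** Two letters of generators can fail to commute only when their sites, each
    relative to the position of the walker, differ by an element of [D]. *)
Definition clashes_in (S : {fset wreath H G}) (D : seq G) : Prop :=
  forall s s' g g', s \in S -> s' \in S -> (g' - g)%R \notin D ->
    commute (lamps s g) (lamps s' g').

(** It suffices that the two commutators have commuting lamps at each site. An
    element commuting with all factors of a product commutes with it, and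
    applying this to both commutators leaves pairs of letters. *)
Lemma metabelian_law_of_no_clash (S : {fset wreath H G}) (D : seq G)
    x y z w n t :
  clashes_in S D ->
  (forall i, (i < n)%N ->
     [/\ x i t \in S, y i t \in S, z i t \in S & w i t \in S]) ->
  (forall i j c c', (i < n)%N -> (j < n)%N -> c \in visit_times n i ->
     c' \in visit_times n j -> (visit x y t c - visit z w t c')%R \notin D) ->
  metabelian_law (walk x n t) (walk y n t) (walk z n t) (walk w n t).
Proof.
move=> clash stepS far; apply: commutator_eq1; rewrite ?pos_commutator // => g.
apply: (@commutator_walk_commute S) => [i /stepS[]//|j c' s' nj c'j s'S].
apply: commute_sym.
apply: (@commutator_walk_commute S) => [i /stepS[]//|i c s ni ci sS].
apply: commute_sym; apply: clash => //.
by rewrite opprB addrC addrA subrK; apply: far ni nj ci c'j.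
Qed.

End WalkLamps.

Section SwitchSites.
Local Open Scope group_scope.
Variables (H : groupType) (a b : H) (r k : nat).

Definition lattice_steps : seq 'rV[int]_5 :=
  [seq std_gen i | i <- enum 'I_5] ++ [seq (- std_gen i)%R | i <- enum 'I_5].

Definition near_sites : seq 'rV[int]_5 :=
  [seq (std_gen ord0 *+ j)%R | j <- iota 0 r].

Definition far_site : 'rV[int]_5 := (std_gen ord0 *+ k)%R.

(** The identity is admitted at both kinds of site, so that elements with
    fewer than two switches have the form [switch_move] as well. *)
Definition switch_at (h : H) (p : 'rV[int]_5) : Prop :=
  (h \in [:: 1; a; a^-1] /\ p \in near_sites) \/
  (h \in [:: 1; b; b^-1] /\ p = far_site).

Definition switch_move (s : wreath H 'rV[int]_5) : Prop :=
  exists h p g h' p', [/\ switch_at h p, g \in lattice_steps, switch_at h' p' &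
    s = lamp h p * move H g * lamp h' p'].

Definition step_offsets : seq 'rV[int]_5 := 0%R :: lattice_steps.

(** Letters at two near sites, or both at the far site, are powers of one
    element. The second switch of a generator happens after its move, hence
    the offsets. *)
Definition clash_sites : seq 'rV[int]_5 :=
  [seq (e + o)%R | e <- [seq (far_site - p)%R | p <- near_sites]
                        ++ [seq (p - far_site)%R | p <- near_sites],
                   o <- [seq (u - v)%R | u <- step_offsets, v <- step_offsets]].

Lemma switch_move_cases s g : switch_move s ->
  exists h p h' p' u, [/\ switch_at h p, switch_at h' p', u \in step_offsets &
    lamps s g = lamps (lamp h p) g * lamps (lamp h' p') (g - u)%R].
Proof.
move=> [h [p [m [h' [p' [hp mS hp' ->]]]]]]; exists h, p, h', p', m.
split=> //; first by rewrite inE mS orbT.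
by rewrite !lampsM posM lamps_move mulg1 -[pos (lamp h p)]/(0%R) add0r.
Qed.

Lemma switch_at_commute h p h' p' g g' u u' :
  switch_at h p -> switch_at h' p' -> u \in step_offsets -> u' \in step_offsets ->
  (g' - g)%R \notin clash_sites ->
  commute (lamps (lamp h p) (g - u)%R) (lamps (lamp h' p') (g' - u')%R).
Proof.
move=> hp h'p' uS u'S; rewrite !lamps_lamp.
case: eqP => [gu|_ _]; last exact/commute_sym/commute1.
case: eqP => [g'u'|_ _]; last exact/commute1.
have commc (c l l' : H) : l \in [:: 1; c; c^-1] -> l' \in [:: 1; c; c^-1] ->
    commute l l'.
  have comml l0 : l0 \in [:: 1; c; c^-1] -> commute c l0.
    by rewrite !inE => /or3P[] /eqP ->; [exact: commute1|exact: commute_refl|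
      exact/commuteV/commute_refl].
  move=> lc l'c; move: lc; rewrite !inE => /or3P[] /eqP ->.
  - exact/commute_sym/commute1.
  - exact: comml.
  - exact/commute_sym/commuteV/commute_sym/comml.
have gg : (g' - g = (p' - p) + (u' - u))%R.
  have -> : g = (p + u)%R by rewrite -gu subrK.
  have -> : g' = (p' + u')%R by rewrite -g'u' subrK.
  by rewrite opprD addrACA.
move: hp h'p' => [[ha pn]|[hb pf]] [[h'a p'n]|[h'b p'f]] gclash.
- exact: commc ha h'a.
- case/negP: gclash; rewrite gg; apply: (allpairs_f (fun e o => e + o)%R).
    rewrite mem_cat p'f; apply/orP; left.
    by apply: (map_f (fun p => far_site - p)%R).
  exact: (allpairs_f (fun u v => u - v)%R).
- case/negP: gclash; rewrite gg; apply: (allpairs_f (fun e o => e + o)%R).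
    rewrite mem_cat pf; apply/orP; right.
    by apply: (map_f (fun p => p - far_site)%R).
  exact: (allpairs_f (fun u v => u - v)%R).
- exact: commc hb h'b.
Qed.

Lemma switch_move_clashes_in (S : {fset wreath H 'rV[int]_5}) :
  (forall s, s \in S -> switch_move s) -> clashes_in S clash_sites.
Proof.
move=> smS s s' g g' /smS/(switch_move_cases g)[h [p [l [q [u [hp lq uS ->]]]]]].
move=> /smS/(switch_move_cases g')[h' [p' [l' [q' [u' [hp' lq' u'S ->]]]]]] gg.
have S0 : 0%R \in step_offsets by rewrite inE eqxx.
have comm h1 p1 h2 p2 u1 u2 := @switch_at_commute h1 p1 h2 p2 g g' u1 u2.
apply: commuteM; apply: commute_sym; apply: commuteM; apply: commute_sym.
- by rewrite -[g]subr0 -[g']subr0; apply: comm.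
- by rewrite -[g']subr0; apply: comm.
- by rewrite -[g]subr0; apply: comm.
- exact: comm.
Qed.

Lemma lattice_steps_coord u : u \in step_offsets -> (`|u 0%R 0%R| <= 1)%N.
Proof.
rewrite inE => /orP[/eqP->|]; first by rewrite mxE.
rewrite mem_cat => /orP[] /mapP[i _ ->]; rewrite /std_gen !mxE /=.
  by case: eqP.
by case: eqP.
Qed.

Lemma clash_sites_coord e : e \in clash_sites -> (k <= `|e 0%R 0%R| + r + 2)%N.
Proof.
have arith (j : nat) (x y : int) : (j < r)%N -> (`|x| <= 1)%N -> (`|y| <= 1)%N ->
    (k <= `|(k%:Z - j%:Z + (x - y))%R| + r + 2)%N.
  by lia.
have arith' (j : nat) (x y : int) : (j < r)%N -> (`|x| <= 1)%N -> (`|y| <= 1)%N ->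
    (k <= `|(j%:Z - k%:Z + (x - y))%R| + r + 2)%N.
  by lia.
have addE (x y : 'rV[int]_5) : (x + y)%R 0%R 0%R = (x 0%R 0%R + y 0%R 0%R)%R.
  by rewrite mxE.
have oppE (x : 'rV[int]_5) : (- x)%R 0%R 0%R = (- x 0%R 0%R)%R by rewrite mxE.
have near p : p \in near_sites -> exists2 j, (j < r)%N & p 0%R 0%R = j%:Z.
  move=> /mapP[j]; rewrite mem_iota add0n => jr ->; exists j => //.
  exact: far_coord.
have farE : far_site 0%R 0%R = k%:Z by apply: far_coord.
rewrite /clash_sites => /allpairsP[[f o] [fS oS ->]].
move: fS oS; rewrite [fst _]/= [snd _]/= => fS.
move=> /allpairsP[[u v] [/lattice_steps_coord u1 /lattice_steps_coord v1 ->]].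
rewrite [fst _]/= [snd _]/= in u1 v1 *.
move: u1 v1; rewrite mem_cat in fS; move: fS => /orP[] /mapP[p /near[j jr pj] ->].
  by rewrite !(addE, oppE) farE pj; apply: arith.
by rewrite !(addE, oppE) farE pj; apply: arith'.
Qed.

Lemma size_clash_sites : size clash_sites = ((r + r) * (11 * 11))%N.
Proof.
have sz : size step_offsets = 11%N.
  rewrite -[size step_offsets]/(size lattice_steps).+1 /lattice_steps size_cat.
  by rewrite (size_map (fun i => std_gen i)) (size_map (fun i => - std_gen i)%R)
     size_enum_ord.
rewrite /clash_sites (size_allpairs (fun e o => e + o)%R) size_cat.
by rewrite (size_allpairs (fun u v => u - v)%R) !size_map size_iota sz.
Qed.

End SwitchSites.

(** * Cardinality of the generating sets *)

Lemma card_imfset2_inj (I J K : choiceType) (f : I -> J -> K)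
    (A : {fset I}) (B : {fset J}) :
  (forall i i' j j', i \in A -> i' \in A -> j \in B -> j' \in B ->
     f i j = f i' j' -> i = i' /\ j = j') ->
  #|` [fset f i j | i in A, j in B]%fset| = (#|` A| * #|` B|)%N.
Proof.
move=> f_inj; rewrite card_fset_sum1 big_imfset2 /=.
  rewrite (eq_bigr (fun=> #|` B| * 1)%N) => [|i _].
    by rewrite -big_distrr /= sum1_size mulnC.
  by rewrite sum1_size muln1.
move=> [i j] [i' j'] /andP[iA jB] /andP[iA' jB'] /= fij.
by have [-> ->] := f_inj i i' j j' iA iA' jB jB' fij.
Qed.

Lemma cardfsU_disjoint (K : choiceType) (A B : {fset K}) :
  (forall x, x \in A -> x \in B -> False) ->
  #|` (A `|` B)%fset| = (#|` A| + #|` B|)%N.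
Proof.
move=> dis; rewrite cardfsU (_ : (A `&` B)%fset = fset0) ?cardfs0 ?subn0 //.
by apply/fsetP => u; rewrite in_fsetI in_fset0; apply/negP => /andP[/dis].
Qed.

(** If a step is uniform on [S], its position is then uniform on the ten
    lattice steps; an upper bound on the ten probabilities is the convenient
    form. *)
Definition balanced (H : groupType) (S : {fset wreath H 'rV[int]_5}) : Prop :=
  [/\ (0 < #|` S|)%N, forall s, s \in S -> pos s \in lattice_steps
    & forall g, g \in lattice_steps ->
        (10 * #|` [fset s in S | pos s == g]%fset| <= #|` S|)%N].

Lemma std_gen_inj : injective std_gen.
Proof.
move=> i j /(congr1 (fun v : 'rV[int]_5 => v 0 i)); rewrite /std_gen !mxE !eqxx /=.
by case: eqP.
Qed.

Lemma std_gen_neq_opp (i j : 'I_5) : std_gen i != - std_gen j.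
Proof.
apply/eqP => /(congr1 (fun v : 'rV[int]_5 => v 0 i)); rewrite /std_gen !mxE !eqxx /=.
by case: eqP.
Qed.

Section ExplicitCount.
Local Open Scope group_scope.
Variables (H : groupType) (a b : H) (k : nat).
Hypothesis k_gt1 : (1 < k)%N.

Notation far := (std_gen ord0 *+ k)%R.

Lemma card_moves : #|` moves H| = 10%N.
Proof.
have mI : injective (fun i => move H (std_gen i)).
  by move=> i j /(congr1 (@pos _ _)); apply: std_gen_inj.
have mI' : injective (fun i => move H (- std_gen i)%R).
  by move=> i j /(congr1 (@pos _ _)) /oppr_inj; apply: std_gen_inj.
rewrite /moves cardfsU_disjoint => [|_ /imfsetP[i /= _ ->] /imfsetP[j /= _]].
  by rewrite !card_imfset //= -!cardE card_ord.
by move=> /(congr1 (@pos _ _)) /= /eqP; rewrite (negPf (std_gen_neq_opp i j)).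
Qed.

Lemma move_pos m : m \in moves H -> m = move H (pos m).
Proof. by move=> /moves_cases[i [] ->]. Qed.

Lemma moves_steps m : m \in moves H -> pos m \in lattice_steps.
Proof.
move=> /moves_cases[i mE]; rewrite mem_cat; apply/orP.
by case: mE => ->; [left|right]; apply/mapP; exists i; rewrite ?mem_enum.
Qed.

Lemma switches_pos s : s \in switches a b k -> pos s = 0%R.
Proof. by move=> /switches_cases[[]|[]] ->. Qed.

Lemma switches_off s x : s \in switches a b k -> x != 0%R -> x != far ->
  lamps s x = 1.
Proof.
move=> /switches_cases sE x0 xf.
by case: sE => [[]|[]] ->; rewrite lamps_lamp ?(negPf x0) ?(negPf xf).
Qed.

Lemma far_moves g x : g \in lattice_steps -> x = 0%R \/ x = far ->
  (x - g)%R != 0%R /\ (x - g)%R != far.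
Proof.
move=> gS; have g1 : (`|g 0%R 0%R| <= 1)%N.
  by apply: lattice_steps_coord; rewrite inE gS orbT.
have g0 : g != 0%R.
  apply/eqP => g0; move: gS; rewrite g0 mem_cat => /orP[] /mapP[i _].
    move=> /(congr1 (fun v : 'rV[int]_5 => v 0%R i)).
    by rewrite /std_gen !mxE !eqxx.
  move=> /(congr1 (fun v : 'rV[int]_5 => v 0%R i)).
  by rewrite /std_gen !mxE !eqxx.
have fE : far 0%R 0%R = k%:Z by apply: far_coord.
move=> [->|->]; split.
- by rewrite sub0r oppr_eq0.
- apply/eqP => /(congr1 (fun v : 'rV[int]_5 => v 0%R 0%R)).
  rewrite fE sub0r mxE; move: (g 0%R 0%R : int) g1 => y; lia.
- apply/eqP => /(congr1 (fun v : 'rV[int]_5 => v 0%R 0%R)).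
  rewrite mxE fE [X in (_ + X)%R]mxE [RHS]mxE; move: (g 0%R 0%R : int) g1 => y; lia.
- by rewrite -subr_eq0 addrAC subrr sub0r oppr_eq0.
Qed.

(** The second switch lands next to the sites 0 and [far] without hitting
    them, so the lamps at these two sites show the first switch. *)
Lemma switch_move_switch_inj s1 m s2 s1' m' s2' :
  s1 \in switches a b k -> m \in moves H -> s2 \in switches a b k ->
  s1' \in switches a b k -> m' \in moves H -> s2' \in switches a b k ->
  s1 * m * s2 = s1' * m' * s2' -> [/\ s1 = s1', m = m' & s2 = s2'].
Proof.
move=> s1S mM s2S s1S' mM' s2S' E.
have mm : m = m'.
  rewrite (move_pos mM) (move_pos mM'); congr move.
  have := congr1 (@pos _ _) E.
  rewrite !posM (switches_pos s1S) (switches_pos s2S) (switches_pos s1S').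
  by rewrite (switches_pos s2S') !add0r !addr0.
suff ss : s1 = s1'.
  by split=> //; move: E; rewrite mm ss => /mulgI.
apply: wreath_ext => [x|]; last by rewrite !switches_pos.
have prodE t1 t t2 : t1 \in switches a b k -> t \in moves H ->
    t2 \in switches a b k -> x = 0%R \/ x = far ->
    lamps (t1 * t * t2) x = lamps t1 x.
  move=> t1S tM t2S xE; have [x0 xf] := far_moves (moves_steps tM) xE.
  rewrite !lampsM posM (switches_pos t1S) add0r (switches_off t2S) // mulg1.
  by rewrite (move_pos tM) lamps_move mulg1.
have [x0|x0] := eqVneq x 0%R.
  by rewrite -(prodE s1 m s2) ?E ?(prodE s1' m' s2') //; left.
have [xf|xf] := eqVneq x far.
  by rewrite -(prodE s1 m s2) ?E ?(prodE s1' m' s2') //; right.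
by rewrite !switches_off.
Qed.

Lemma card_switch_move_switch :
  #|` switch_move_switch a b k| = (#|` switches a b k| ^ 2 * 10)%N.
Proof.
rewrite /switch_move_switch card_imfset2_inj; last first.
  move=> s s' s2 s2' /imfset2P[s1 /= s1S [m /= mM ->]].
  move=> /imfset2P[s1' /= s1S' [m' /= mM' ->]] s2S s2S' E.
  by have [-> -> ->] := switch_move_switch_inj s1S mM s2S s1S' mM' s2S' E.
rewrite card_imfset2_inj; last first.
  move=> s1 s1' m m' s1S s1S' mM mM' E.
  have E2 : s1 * m * s1 = s1' * m' * s1 by rewrite E.
  by have [-> -> _] := switch_move_switch_inj s1S mM s1S s1S' mM' s1S E2.
by rewrite card_moves -mulnn mulnAC.
Qed.

Lemma switch_move_switch_balanced : balanced (switch_move_switch a b k).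
Proof.
have sw0 : lamp a 0%R \in switches a b k by apply/switches_cases; left; left.
have swc : (0 < #|` switches a b k|)%N.
  by rewrite cardfs_gt0; apply/fset0Pn; exists (lamp a 0%R).
rewrite /balanced card_switch_move_switch; split.
- by rewrite muln_gt0 expn_gt0 swc.
- move=> _ /switch_move_switchP[s1 [m [s2 [s1S mM s2S ->]]]].
  by rewrite !posM (switches_pos s1S) (switches_pos s2S) add0r addr0 moves_steps.
move=> g gS; rewrite mulnC leq_mul2r /= -mulnn.
rewrite -(@card_imfset2_inj _ _ _ (fun s1 s2 => s1 * move H g * s2)).
  apply: fsubset_leq_card; apply/fsubsetP => u; rewrite !inE /= => /andP[].
  move=> /switch_move_switchP[s1 [m [s2 [s1S mM s2S ->]]]].
  rewrite !posM (switches_pos s1S) (switches_pos s2S) add0r addr0 => /eqP <-.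
  by rewrite -(move_pos mM); apply/imfset2P; exists s1 => //; exists s2.
move=> s1 s1' s2 s2' s1S s1S' s2S s2S' E.
have gM : move H g \in moves H.
  apply/moves_cases; move: gS; rewrite mem_cat => /orP[] /mapP[i _ ->]; exists i;
  by [left|right].
by have [-> _ ->] := switch_move_switch_inj s1S gM s2S s1S' gM s2S' E.
Qed.

Lemma switch_move_switch_switch_move (r : nat) s : (0 < r)%N ->
  s \in switch_move_switch a b k -> switch_move a b r k s.
Proof.
move=> r_gt0 /switch_move_switchP[s1 [m [s2 [s1S mM s2S ->]]]].
have swE t : t \in switches a b k ->
    exists h p, switch_at a b r k h p /\ t = lamp h p.
  have n0 : 0%R \in near_sites r.
    by apply/mapP; exists 0%N; rewrite ?mulr0n // mem_iota.
  move=> /switches_cases[[]|[]] ->; do 2!eexists; split; try reflexivity.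
  - by left; rewrite !inE eqxx !orbT.
  - by left; rewrite !inE eqxx !orbT.
  - by right; rewrite !inE eqxx !orbT.
  - by right; rewrite !inE eqxx !orbT.
have [h [p [hp ->]]] := swE _ s1S; have [h' [p' [hp' ->]]] := swE _ s2S.
exists h, p, (pos m), h', p'; split=> //; first exact: moves_steps.
by rewrite -(move_pos mM).
Qed.

Lemma card_switches : a <> 1 -> (a * a) <> 1 -> (b * b) <> 1 ->
  #|` switches a b k| = 4%N.
Proof.
move=> a1 aa bb.
have far0 : far != 0%R.
  apply/eqP => /(congr1 (fun v : 'rV[int]_5 => v 0%R 0%R)).
  by rewrite far_coord mxE; lia.
have lampI (h h' : H) (x : 'rV[int]_5) : lamp h x = lamp h' x -> h = h'.
  move=> E; have := congr1 (fun u => lamps u x) E.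
  by rewrite !lamps_lamp eqxx.
have lampN h h' (x x' : 'rV[int]_5) : x != x' -> h <> 1 -> lamp h x <> lamp h' x'.
  move=> xx' h1 E; have := congr1 (fun u => lamps u x) E.
  by rewrite !lamps_lamp eqxx (negPf xx').
have sq (h : H) : h = h^-1 -> h * h = 1 by move=> E; rewrite {2}E mulgV.
have a1' : a^-1 <> 1 by move=> E; apply: a1; rewrite -[a]invgK E invg1.
have n1 : lamp a 0%R != lamp a^-1 0%R :> wreath H 'rV[int]_5.
  by apply/eqP => /lampI /sq.
have n2 : lamp b far != lamp b^-1 far by apply/eqP => /lampI /sq.
have n3 h : lamp a 0%R != lamp h far by apply/eqP/lampN; rewrite // eq_sym.
have n4 h : lamp a^-1 0%R != lamp h far by apply/eqP/lampN; rewrite // eq_sym.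
rewrite /switches cardfsU_disjoint => [|u]; last first.
  rewrite !in_fsetU !in_fset1 => /orP[/orP[]|] /eqP -> /eqP E.
  - by move/eqP: (n3 b^-1).
  - by move/eqP: (n4 b^-1).
  - by move/eqP: n2.
rewrite cardfsU_disjoint => [|u]; last first.
  rewrite !in_fsetU !in_fset1 => /orP[] /eqP -> /eqP E.
    by move/eqP: (n3 b).
  by move/eqP: (n4 b).
by rewrite cardfs2 n1 !cardfs1.
Qed.

End ExplicitCount.

Section SpreadGenerators.
Local Open Scope group_scope.
Variables (H : groupType) (a b : H) (k : nat).
Hypotheses (a_neq1 : a <> 1) (b_neq1 : b <> 1) (k_ge14 : (14 <= k)%N).

Notation far := (std_gen ord0 *+ k)%R.

(** Sixteen switches for each of the ten directions give 160 elements whatever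
    the orders of [a] and [b] are: [b] at the far site, the identity, and [a]
    at fourteen sites. *)
Definition spread_switches : {fset wreath H 'rV[int]_5} :=
  (lamp b far |`
     (1 |` [fset lamp a (std_gen ord0 *+ nat_of_ord j)%R | j in 'I_14]))%fset.

Definition positive_moves : {fset wreath H 'rV[int]_5} :=
  [fset move H (std_gen i) | i in 'I_5]%fset.

(** With the identity among the switches, the positive moves belong to the set
    themselves, so it generates without any parity obstruction. *)
Definition spread_half : {fset wreath H 'rV[int]_5} :=
  [fset u * m | u in spread_switches, m in positive_moves]%fset.

Definition spread_generators : {fset wreath H 'rV[int]_5} :=
  (spread_half `|` [fset s^-1 | s in spread_half])%fset.

Lemma spread_switchesP u : u \in spread_switches ->
  exists h p, switch_at a b 14 k h p /\ u = lamp h p.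
Proof.
rewrite !in_fsetU !in_fset1 => /or3P[/eqP->|/eqP->|/imfsetP[j /= _ ->]].
- by exists b, far; split=> //; right; rewrite !inE eqxx orbT.
- by exists 1, far; rewrite lamp1; split=> //; right; rewrite !inE eqxx.
- exists a, (std_gen ord0 *+ j)%R; split=> //; left.
  split; first by rewrite !inE eqxx orbT.
  by apply/mapP; exists (j : nat); rewrite // mem_iota /=.
Qed.

Lemma spread_switches_pos u : u \in spread_switches -> pos u = 0%R.
Proof. by move=> /spread_switchesP[h [p [_ ->]]]. Qed.

Lemma spread_halfP s : s \in spread_half ->
  exists2 u, u \in spread_switches & exists i, s = u * move H (std_gen i).
Proof.
by move=> /imfset2P[u /= uS [_ /imfsetP[i _ ->] ->]]; exists u => //; exists i.
Qed.

Lemma mem_spread_half u i : u \in spread_switches ->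
  u * move H (std_gen i) \in spread_half.
Proof.
move=> uS; apply/imfset2P; exists u => //; exists (move H (std_gen i)) => //.
by apply/imfsetP; exists i.
Qed.

Lemma card_spread_switches : #|` spread_switches| = 16%N.
Proof.
have lampE (h h' : H) (x x' y : 'rV[int]_5) : lamp h x = lamp h' x' ->
    (if y == x then h else 1) = (if y == x' then h' else 1).
  by move=> E; have := congr1 (fun u => lamps u y) E; rewrite !lamps_lamp.
have siteI (i j : nat) : (std_gen ord0 *+ i = std_gen ord0 *+ j)%R -> i = j.
  by move=> /(congr1 (fun v : 'rV[int]_5 => v 0%R 0%R)); rewrite !far_coord => -[].
rewrite cardfsU_disjoint => [|u]; last first.
  rewrite !in_fsetU !in_fset1 => /eqP -> /orP[/eqP|/imfsetP[j /= _]].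
    by rewrite -(lamp1 _ far) => /lampE - /(_ far); rewrite eqxx.
  move=> /lampE - /(_ far); rewrite eqxx; case: eqP => // /siteI kj.
  by have := ltn_ord j; lia.
rewrite cardfsU_disjoint => [|u]; last first.
  rewrite !in_fset1 => /eqP -> /imfsetP[j /= _].
  rewrite -(lamp1 _ (std_gen ord0 *+ j)%R) => /lampE - /(_ (std_gen ord0 *+ j)%R).
  by rewrite eqxx => /esym.
rewrite !cardfs1 card_imfset /=; first by rewrite -cardE card_ord.
move=> i j /lampE - /(_ (std_gen ord0 *+ i)%R); rewrite eqxx.
by case: eqP => // /siteI /ord_inj.
Qed.

Lemma card_positive_moves : #|` positive_moves| = 5%N.
Proof.
rewrite card_imfset /=; first by rewrite -cardE card_ord.
by move=> i j /(congr1 (@pos _ _)); apply: std_gen_inj.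
Qed.

Lemma card_spread_generators : #|` spread_generators| = 160%N.
Proof.
have half : #|` spread_half| = 80%N.
  rewrite card_imfset2_inj ?card_spread_switches ?card_positive_moves //.
  move=> u u' _ _ uS u'S /imfsetP[i /= _ ->] /imfsetP[i' /= _ ->] E.
  have := congr1 (@pos _ _) E; rewrite !posM (spread_switches_pos uS).
  rewrite (spread_switches_pos u'S) !add0r => /std_gen_inj ii'.
  by move: E; rewrite ii' => /mulIg.
rewrite cardfsU_disjoint => [|s /spread_halfP[u uS [i ->]]].
  by rewrite card_imfset ?half //; apply: invg_inj.
move=> /imfsetP[s' /= /spread_halfP[u' u'S [j ->]]] /(congr1 (@pos _ _)).
rewrite posV !posM (spread_switches_pos uS) (spread_switches_pos u'S) !add0r.
by move/eqP; rewrite (negPf (std_gen_neq_opp i j)).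
Qed.

Lemma spread_generators_symmetric : symmetric_fset spread_generators.
Proof.
move=> s; rewrite !in_fsetU => /orP[sS|/imfsetP[s' /= s'S ->]].
  by apply/orP; right; apply/imfsetP; exists s.
by rewrite invgK s'S.
Qed.

Lemma spread_generators_generate : generates [set a; b]%classic ->
  generates [set` spread_generators]%classic.
Proof.
move=> genab; rewrite /generates; set K := smallest _ _.
have subK : is_subgroup K by apply: is_subgroup_smallest.
have [K1 KM KV] := subK.
have KS u i : u \in spread_switches -> K (u * move H (std_gen i)).
  move=> uS L [_ SL]; apply: SL => /=; rewrite in_fsetU.
  by apply/orP; left; apply: mem_spread_half.
have Kmove i : K (move H (std_gen i)).
  by rewrite -[move _ _]mul1g; apply: KS; rewrite !in_fsetU !in_fset1 eqxx orbT.
have Klamp h x y : lamp h x \in spread_switches -> K (lamp h y).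
  move=> hS; have Kh : K (lamp h x).
    by have := KM _ _ (KS _ 0%R hS) (KV _ (Kmove 0%R)); rewrite mulgK.
  have := move_lamp (y - x)%R h x; rewrite [(x + _)%R]addrC subrK => <-.
  by apply: (KM); [apply: (KM) => //|]; apply: move_lattice.
apply/seteqP; split=> // u _; apply: (lattice_lamps_total subK genab) => // x.
  apply: (Klamp _ (std_gen ord0 *+ 0)%R); rewrite !in_fsetU; apply/or3P/Or33.
  by apply/imfsetP; exists (ord0 : 'I_14).
by apply: (Klamp _ far); rewrite !in_fsetU !in_fset1 eqxx.
Qed.

Lemma spread_generators_switch_move s :
  s \in spread_generators -> switch_move a b 14 k s.
Proof.
have step i : std_gen i \in lattice_steps /\ (- std_gen i)%R \in lattice_steps.
  by rewrite !mem_cat; split; apply/orP; [left|right]; apply/mapP; exists i;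
    rewrite ?mem_enum.
have triv : switch_at a b 14 k 1 far by right; rewrite inE eqxx.
have inv3 (c h : H) : h \in [:: 1; c; c^-1] -> h^-1 \in [:: 1; c; c^-1].
  by rewrite !inE => /or3P[] /eqP ->; rewrite ?invg1 ?invgK eqxx ?orbT.
rewrite in_fsetU => /orP[|/imfsetP[s' /= + ->]].
  move=> /spread_halfP[_ /spread_switchesP[h [p [hp ->]]] [i ->]].
  exists h, p, (std_gen i), 1, far; split=> //; first by have [] := step i.
  by rewrite lamp1 mulg1.
move=> /spread_halfP[_ /spread_switchesP[h [p [hp ->]]] [i ->]].
exists 1, far, (- std_gen i)%R, h^-1, p; split=> //; first by have [] := step i.
  by case: hp => -[/inv3 hc pE]; [left|right].
by rewrite lamp1 mul1g invgM lampV moveN.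
Qed.

Lemma spread_generators_balanced : balanced spread_generators.
Proof.
have fiber (f : wreath H 'rV[int]_5 -> wreath H 'rV[int]_5)
    (A : {fset wreath H 'rV[int]_5}) :
    (forall s, s \in A -> exists2 u, u \in spread_switches & s = f u) ->
    (10 * #|` A| <= 160)%N.
  move=> AE; rewrite -[160%N]/(10 * 16)%N leq_mul2l /= -card_spread_switches.
  apply: (@leq_trans #|` [fset f u | u in spread_switches]%fset|); last first.
    exact: leq_imfset_card.
  apply: fsubset_leq_card.
  by apply/fsubsetP => s /AE[u uS ->]; apply/imfsetP; exists u.
rewrite /balanced card_spread_generators; split=> // [s|g].
  move=> /spread_generators_switch_move[h [p [g [h' [p' [_ gS _ ->]]]]]].
  by rewrite !posM add0r addr0.
rewrite mem_cat => /orP[] /mapP[i _ ->].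
  apply: (fiber (fun u => u * move H (std_gen i))) => s.
  rewrite !inE /= => /andP[/orP[/spread_halfP[u uS [j ->]]|/imfsetP[s' /= +]]].
    by rewrite posM (spread_switches_pos uS) add0r => /eqP/std_gen_inj ->; exists u.
  move=> /spread_halfP[u uS [j ->]] ->.
  rewrite posV posM (spread_switches_pos uS) add0r eq_sym.
  by rewrite (negPf (std_gen_neq_opp _ _)).
apply: (fiber (fun u => (u * move H (std_gen i))^-1)) => s.
rewrite !inE /= => /andP[/orP[/spread_halfP[u uS [j ->]]|/imfsetP[s' /= +]]].
  rewrite posM (spread_switches_pos uS) add0r.
  by rewrite (negPf (std_gen_neq_opp _ _)).
move=> /spread_halfP[u uS [j ->]] ->.
rewrite posV posM (spread_switches_pos uS) add0r => /eqP/oppr_inj/std_gen_inj ->.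
by exists u.
Qed.

End SpreadGenerators.

(** * Discrete random elements and union bounds *)

Local Open Scope classical_set_scope.
Local Open Scope ring_scope.

Lemma limn_einf_ge (R : realType) (u : nat -> \bar R) (p : \bar R) :
  (forall n, p <= u n)%E -> (p <= limn_einf u)%E.
Proof.
move=> pu; rewrite limn_einf_lim; apply: lime_ge; first exact: is_cvg_einfs.
by apply: nearW => n; apply: le_ereal_inf_tmp => _ [m _ <-].
Qed.

Section Discrete.
Context {d : measure_display} {T : measurableType d}.

(** Measurability for the discrete sigma-algebra on [X]. *)
Definition discrete (X : Type) (f : T -> X) : Prop :=
  forall B : set X, measurable (f @^-1` B).

Lemma discrete_comp (X Y : Type) (h : X -> Y) (f : T -> X) :
  discrete f -> discrete (fun t => h (f t)).
Proof. by move=> df B; apply: (df (h @^-1` B)). Qed.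

Lemma discrete_cst (X : Type) (c : X) : discrete (fun _ : T => c).
Proof.
move=> B; have [Bc|nBc] := pselect (B c).
  by rewrite (_ : _ @^-1` _ = setT) //; apply/seteqP; split.
by rewrite (_ : _ @^-1` _ = set0) //; apply/seteqP; split.
Qed.

(** Cut the event along the countably many values of [f]. *)
Lemma discrete_pair (X Y : Type) (f : T -> X) (g : T -> Y) :
  countable [set: X] -> discrete f -> discrete g ->
  discrete (fun t => (f t, g t)).
Proof.
move=> cX df dg B; rewrite (_ : _ @^-1` _ =
  \bigcup_x (f @^-1` [set x] `&` g @^-1` [set y | B (x, y)])); last first.
  apply/seteqP; split=> [t Bt|t [x _ [/= -> //]]].
  by exists (f t).
apply: countable_bigcupT_measurable => // x.
by apply: measurableI; [apply: df|apply: dg].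
Qed.

Lemma discrete_sum (X : countZmodType) (I : Type) (s : seq I) (f : I -> T -> X) :
  (forall i, discrete (f i)) -> discrete (fun t => \sum_(i <- s) f i t).
Proof.
move=> df; elim: s => [|i s IHs].
  by under [X in discrete X]eq_fun do rewrite big_nil; apply: discrete_cst.
under [X in discrete X]eq_fun do rewrite big_cons.
apply: (@discrete_comp _ _ (fun p : X * X => p.1 + p.2)
  (fun t => (f i t, \sum_(j <- s) f j t))).
by apply: discrete_pair => //; apply: countableP.
Qed.

End Discrete.

Section UnionBound.
Context {R : realType} {d : measure_display} {T : measurableType d}.
Variable P : probability T R.

(** The union bound, up to a null event [N]. *)
Lemma prob_le_sum (I : eqType) (s : seq I) (A : I -> set T) (N B : set T) :
  measurable B -> measurable N -> (forall i, measurable (A i)) -> P N = 0%E ->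
  (forall t, B t -> N t \/ exists2 i, i \in s & A i t) ->
  (P B <= \sum_(i <- s) P (A i))%E.
Proof.
move=> mB mN mA N0; elim: s B mB => [|i s IHs] B mB BNA.
  rewrite big_nil -N0 le_measure ?inE // => t /BNA[//|[i]].
  by rewrite in_nil.
rewrite big_cons; apply: (@le_trans _ _ (P (A i) + P (B `\` A i))%E).
  have mD : measurable (B `\` A i) by apply: measurableD.
  apply: le_trans (@measureU2 _ _ _ P _ _ (mA i) mD).
  apply: le_measure; rewrite ?inE //; first exact: measurableU.
  by move=> t Bt; have [At|nAt] := pselect (A i t); [left|right].
apply: leeD2l; apply: IHs; first exact: measurableD.
move=> t [/BNA[|[j]]]; first by left.
by rewrite inE => /orP[/eqP ->|js]; [|right; exists j].
Qed.

Lemma prob_preimage_seq (X : eqType) (f : T -> X) (s : seq X) :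
  discrete f -> uniq s ->
  P (f @^-1` [set` s]) = (\sum_(a <- s) P (f @^-1` [set a]))%E.
Proof.
move=> df; elim: s => [_|a s IHs /= /andP[nas us]].
  by rewrite big_nil (_ : _ @^-1` _ = set0) ?measure0 //; apply/seteqP; split.
rewrite big_cons -IHs // -measureU //.
- congr (P _); apply/seteqP; split=> t /=; rewrite inE.
    by move=> /orP[/eqP|]; [left|right].
  by move=> [->|ts]; rewrite ?eqxx ?ts ?orbT.
- by apply/seteqP; split=> // t [/= -> sa]; rewrite sa in nas.
Qed.

Lemma prod_prob_fin (I : Type) (s : seq I) (A : I -> set T) :
  (forall i, measurable (A i)) ->
  exists2 r : R, 0 <= r & (\prod_(i <- s) P (A i) = r%:E)%E.
Proof.
move=> mA; elim: s => [|i s [r r0 rE]]; first by exists 1; rewrite ?big_nil.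
exists (fine (P (A i)) * r); first by rewrite mulr_ge0 // fine_ge0.
by rewrite big_cons rE EFinM fineK // fin_num_measure.
Qed.

End UnionBound.

Lemma lattice_walks00 (R : pzSemiRingType) (d : nat) :
  lattice_walks R 0 (0 : 'rV[int]_d) = 1.
Proof.
elim: d => [|d IHd] //=; rewrite /binconv big_ord1 subn0 bin0 mulr1n mxE mul1r.
by rewrite (_ : col' 0 0 = 0) ?IHd //; apply/rowP => i; rewrite !mxE.
Qed.

(** * The law of a signed sum of steps *)

Section StepLaw.
Context {R : realType} {d : measure_display} {T : measurableType d}.
Variables (P : probability T R) (H : groupType) (I : choiceType).
Variables (S : {fset wreath H 'rV[int]_5}) (x : I -> T -> wreath H 'rV[int]_5).
Hypotheses (iid : iid_uniform P S x) (balS : balanced S).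

Lemma step_discrete i : discrete (x i).
Proof. by have [mx _ _] := iid; apply: mx. Qed.

Lemma step_in_as i : P (x i @^-1` [set u | u \notin S]) = 0%E.
Proof.
have [mx Px _] := iid; have [S0 _ _] := balS.
rewrite (_ : _ @^-1` _ = ~` (x i @^-1` [set` S])); last first.
  by apply/seteqP; split=> t /=; [move/negP|move/negP].
rewrite probability_setC; last exact: mx.
rewrite (@prob_preimage_seq _ _ _ _ _ _ (enum_fset S)) ?fset_uniq //.
rewrite (eq_big_seq (fun=> (#|` S|%:R^-1)%:E)) => [|s sS]; last exact: Px.
rewrite sumEFin big_const_seq count_predT iter_addr_0 -[_^-1 *+ _]mulr_natr.
rewrite mulVf ?subee //.
by rewrite pnatr_eq0 -lt0n.
Qed.

Lemma step_pos_prob i g : g \in lattice_steps ->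
  (P (x i @^-1` [set u | pos u = g]) <= (10^-1)%:E)%E.
Proof.
have [mx Px _] := iid; have [S0 _ fiber] := balS.
move=> gS; pose F := [fset s in S | pos s == g]%fset.
apply: (@le_trans _ _ (\sum_(s <- F) P (x i @^-1` [set s]))%E).
  apply: (prob_le_sum (N := x i @^-1` [set u | u \notin S])) => //.
    exact: step_in_as.
  move=> t /= xg; have [xS|] := boolP (x i t \in S); last by left.
  by right; exists (x i t) => //; rewrite !inE xS xg eqxx.
rewrite (eq_big_seq (fun=> (#|` S|%:R^-1)%:E)) => [|s]; last first.
  by rewrite !inE => /andP[sS _]; apply: Px.
rewrite sumEFin lee_fin big_const_seq count_predT iter_addr_0 -[_^-1 *+ _]mulr_natr.
rewrite ler_pdivrMl ?ltr0n // ler_pdivlMr ?ltr0n //.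
by rewrite -natrM ler_nat mulnC fiber.
Qed.

Definition signed (sg : bool) (g : 'rV[int]_5) : 'rV[int]_5 :=
  if sg then - g else g.

Definition signed_sum_event (sg : I -> bool) (J : seq I) (v : 'rV[int]_5) :
    set T :=
  [set t | \sum_(i <- J) signed (sg i) (pos (x i t)) = v].

Lemma signed_sum_event_measurable sg J v : measurable (signed_sum_event sg J v).
Proof.
have dsum : discrete (fun t => \sum_(i <- J) signed (sg i) (pos (x i t))).
  apply: (@discrete_sum _ T _ _ J (fun i t => signed (sg i) (pos (x i t)))) => i.
  apply: (@discrete_comp _ _ _ _
    (fun u : wreath H 'rV[int]_5 => signed (sg i) (pos u))).
  exact: step_discrete.
exact: (dsum [set v]).
Qed.

Lemma sum_lattice_steps (sg : bool) (m : nat) (v : 'rV[int]_5) :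
  \sum_(g <- lattice_steps) lattice_walks R m (v - signed sg g) =
  lattice_walks R m.+1 v.
Proof.
have sum_map (f : 'I_5 -> 'rV[int]_5) (F : 'rV[int]_5 -> R) :
    \sum_(g <- [seq f i | i <- enum 'I_5]) F g = \sum_i F (f i).
  by rewrite big_map big_enum.
rewrite lattice_walksS; move: (lattice_walks R m) => W.
rewrite big_split [LHS]big_cat !sum_map.
case: sg; first rewrite [LHS]addrC.
all: by congr (_ + _); apply: eq_bigr => i _; rewrite /signed ?opprK.
Qed.

(** The events [B i] at indices outside [J] carry the independence through the
    induction on [J]: once the displacement of the step [i0] is fixed, the
    index [i0] moves from [J] to [K] together with the event that fixes it,
    and summing over the ten displacements reproduces the recursion of
    [lattice_walks]. *)
Lemma signed_sum_prob (sg : I -> bool) (J : seq I) (K : {fset I})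
    (B : I -> set (wreath H 'rV[int]_5)) (v : 'rV[int]_5) :
  uniq J -> (forall i, i \in J -> i \notin K) ->
  (P (signed_sum_event sg J v `&` \bigcap_(i in [set` K]) (x i @^-1` B i)) <=
   (lattice_walks R (size J) v / 10 ^+ size J)%:E *
   \prod_(i <- K) P (x i @^-1` B i))%E.
Proof.
have [mx Px indep] := iid; have [S0 posS fiber] := balS.
have mcap (L : {fset I}) C : measurable (\bigcap_(i in [set` L]) (x i @^-1` C i)).
  by apply: fin_bigcap_measurable => // i _; apply: mx.
have mE L w := @signed_sum_event_measurable sg L w.
elim: J K B v => [|i0 J IHJ] K B v => [_ _|/andP[i0J uJ] JK].
  have [v0|v0] := eqVneq v 0.
    rewrite v0 [size _]/= expr0 divr1 lattice_walks00 mul1e -indep.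
    by apply: le_measure; rewrite ?inE //; apply: measurableI.
  rewrite (_ : signed_sum_event sg [::] v = set0); last first.
    apply/seteqP; split=> // t; rewrite /signed_sum_event /= big_nil => v0'.
    by rewrite v0' eqxx in v0.
  rewrite set0I measure0; apply: mule_ge0.
    by rewrite lee_fin divr_ge0 ?lattice_walks_ge0 ?exprn_ge0.
  by apply: prode_ge0.
have i0K : i0 \notin K by apply: JK; rewrite inE eqxx.
have [p p0 pE] := prod_prob_fin P (enum_fset K) (fun i => mx i (B i)).
rewrite pE.
pose C g i := if i == i0 then [set u : wreath H 'rV[int]_5 | pos u = g] else B i.
pose A g := signed_sum_event sg J (v - signed (sg i0) g) `&`
  \bigcap_(i in [set` (i0 |` K)%fset]) (x i @^-1` C g i).
apply: (@le_trans _ _ (\sum_(g <- lattice_steps) P (A g))%E).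
  apply: (prob_le_sum (N := x i0 @^-1` [set u | u \notin S])).
  - exact: measurableI.
  - exact: mx.
  - by move=> g; apply: measurableI.
  - exact: step_in_as.
  move=> t [sumv capB]; have [xS|] := boolP (x i0 t \in S); last by left.
  right; exists (pos (x i0 t)); first exact: posS.
  split.
    by rewrite /signed_sum_event /= -sumv big_cons addrAC subrr add0r.
  move=> i /= iK; rewrite /C; case: eqP => [->//|/eqP ii0].
  by apply: capB; move: iK; rewrite /= in_fset1U (negPf ii0).
apply: (@le_trans _ _ (\sum_(g <- lattice_steps)
  (lattice_walks R (size J) (v - signed (sg i0) g) / 10 ^+ size J
     * (10^-1 * p))%:E)%E).
  rewrite [leLHS]big_seq [leRHS]big_seq; apply: lee_sum => g gS.
  apply: le_trans (IHJ _ (C g) _ uJ _) _.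
    move=> i iJ; rewrite in_fset1U negb_or JK ?inE ?iJ ?orbT // andbT.
    by apply: contraNneq i0J => <-.
  rewrite big_fsetU1 //= /C eqxx.
  rewrite (eq_big_seq (fun i => P (x i @^-1` B i))) => [|i iK]; last first.
    by case: eqP => // ii0; rewrite -ii0 iK in i0K.
  have := step_pos_prob i0 gS.
  have mg : measurable (x i0 @^-1` [set u | pos u = g]) by apply: mx.
  rewrite pE -(fineK (fin_num_measure P _ mg)) -!EFinM !lee_fin => q10.
  have W0 := lattice_walks_ge0 R (size J) (v - signed (sg i0) g).
  by apply: ler_wpM2l; [rewrite divr_ge0 ?exprn_ge0|rewrite ler_wpM2r].
rewrite sumEFin lee_fin -mulr_suml -mulr_suml sum_lattice_steps.
rewrite [size _]/= exprSr invfM le_eqVlt; apply/orP; left; apply/eqP.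
by move: (lattice_walks _ _ _) => W; ring.
Qed.

End StepLaw.

Section FourWalks.
Context {R : realType} {d : measure_display} {T : measurableType d}.
Variables (P : probability T R) (H : groupType).
Variables (S : {fset wreath H 'rV[int]_5}).
Variable x : 'I_4 * nat -> T -> wreath H 'rV[int]_5.
Hypotheses (iid : iid_uniform P S x) (balS : balanced S).

Notation RW j := (walk (fun i => x (inord j, i))).
Notation steps j := (fun i => x (inord j, i)).

Definition walk_indices (l : seq nat) : seq ('I_4 * nat) :=
  [seq (inord j, i) | j <- iota 0 4, i <- iota 0 (nth 0%N l j)].

Lemma uniq_walk_indices l : uniq (walk_indices l).
Proof.
apply: allpairs_uniq_dep; first exact: iota_uniq.
  by move=> j _; apply: iota_uniq.
move=> [j i] [j' i'] /allpairsPdep[j1 [i1 [j14 _ [-> ->]]]].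
move=> /allpairsPdep[j2 [i2 [j24 _ [-> ->]]]] /= [].
move: j14 j24; rewrite !mem_iota !add0n /= => j14 j24.
by move=> /(congr1 (@nat_of_ord _)); rewrite !inordK // => -> ->.
Qed.

Definition clash_event (e : 'rV[int]_5) (c c' : nat * nat) : set T :=
  [set t | visit (steps 0) (steps 1) t c - visit (steps 2) (steps 3) t c' = e].

Lemma signed_partial_sum (j n : nat) t : (j < 4)%N ->
  \sum_(i <- iota 0 n) signed (1 < (inord j : 'I_4))%N (pos (x (inord j, i) t)) =
  signed (1 < j)%N (pos (RW j n t)).
Proof.
move=> j4; rewrite inordK // pos_walk -{1}(subn0 n) -/(index_iota 0 n) big_mkord.
by rewrite /signed; case: (1 < j)%N => //; rewrite sumrN.
Qed.

Lemma clash_eventE e c c' : clash_event e c c' =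
  signed_sum_event x (fun ji => (1 < ji.1)%N)
    (walk_indices [:: c.1; c.2; c'.1; c'.2]) e.
Proof.
rewrite /clash_event /signed_sum_event; apply: eq_set => t.
have sumE (l : seq nat) (F : 'I_4 * nat -> 'rV[int]_5) :
    \sum_(ji <- walk_indices l) F ji =
    \sum_(j <- iota 0 4) \sum_(i <- iota 0 (nth 0%N l j)) F (inord j, i).
  exact: big_allpairs_dep.
rewrite sumE [iota 0 4]/= !big_cons big_nil addr0.
by rewrite !signed_partial_sum // /visit /signed /= opprD !addrA.
Qed.

Lemma clash_event_prob e c c' :
  (P (clash_event e c c') <=
   (lattice_walks R (c.1 + c.2 + (c'.1 + c'.2)) e
      / 10 ^+ (c.1 + c.2 + (c'.1 + c'.2)))%:E)%E.
Proof.
rewrite clash_eventE; set J := walk_indices _.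
have := @signed_sum_prob _ _ _ _ _ _ _ _ iid balS (fun ji => (1 < ji.1)%N) J
  fset0 (fun=> setT) e (uniq_walk_indices _) (fun _ _ => isT).
rewrite big_seq_fset0 mule1.
rewrite (_ : \bigcap_(i in _) _ = setT) ?setIT; last by apply/seteqP; split.
have -> : size J = (c.1 + c.2 + (c'.1 + c'.2))%N.
  by rewrite size_allpairs_dep /= !size_iota addn0 !addnA.
by [].
Qed.

End FourWalks.

(** * The probability that the law fails *)

Lemma sum_le_size (R : numDomainType) (I : eqType) (s : seq I) (F : I -> R)
    (c : R) :
  (forall i, i \in s -> F i <= c) -> \sum_(i <- s) F i <= (size s)%:R * c.
Proof.
move=> Fc; rewrite big_seq; apply: le_trans (ler_sum _ Fc) _.
by rewrite -big_seq big_const_seq count_predT iter_addr_0 mulr_natl.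
Qed.

Section LawProbability.
Context {R : realType} {d : measure_display} {T : measurableType d}.
Variables (P : probability T R) (H : groupType).
Variables (S : {fset wreath H 'rV[int]_5}) (D : seq 'rV[int]_5) (K : nat).
Variable x : 'I_4 * nat -> T -> wreath H 'rV[int]_5.
Hypotheses (iid : iid_uniform P S x) (balS : balanced S).
Hypothesis countable_wreath : countable [set: wreath H 'rV[int]_5].
Hypothesis clashS : clashes_in S D.
Hypothesis farD : forall e, e \in D -> (K.+1 < `|e 0%R 0%R|)%N.

Notation RW j := (walk (fun i => x (inord j, i))).

Definition law_event (n : nat) : set T :=
  [set t | metabelian_law (RW 0%N n t) (RW 1%N n t) (RW 2%N n t) (RW 3%N n t)].

Lemma walk_discrete j n : discrete (RW j n).
Proof.
elim: n => [|n IHn]; first exact: discrete_cst.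
apply: (@discrete_comp _ _ _ _ (fun p => (p.1 * p.2)%g)
  (fun t => (RW j n t, x (inord j, n) t))).
by apply: discrete_pair => //; apply: step_discrete iid _.
Qed.

(** The walks take countably many values, so any condition on the four of them
    is measurable. *)
Lemma law_event_measurable n : measurable (law_event n).
Proof.
pose Q := (wreath H 'rV[int]_5 * wreath H 'rV[int]_5)%type.
have cQ : countable [set: Q].
  by rewrite -setXTT; apply: countableX.
have dQ j j' : discrete (fun t => (RW j n t, RW j' n t)).
  by apply: discrete_pair => //; apply: walk_discrete.
have := discrete_pair cQ (dQ 0%N 1%N) (dQ 2%N 3%N).
exact: (fun f => f [set q | metabelian_law q.1.1 q.1.2 q.2.1 q.2.2]).
Qed.

Definition clash_bound : R :=
  (16 * size D)%:R * (4 * Num.sqrt (10 ^+ 5) * rsqrt R K.+1).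

Definition visit_time (n i q : nat) : nat * nat :=
  nth (0, 0)%N (visit_times n i) q.

Lemma visit_time_ge n i q : (q < 4)%N ->
  (i <= (visit_time n i q).1 + (visit_time n i q).2)%N.
Proof. by rewrite /visit_time; case: q => [|[|[|[|q]]]] //= _; lia. Qed.

(** Outside the null event that a step is not in [S], a failure of the law
    provides a clash in [D] between a visit of the first pair and a visit of
    the second. There are 16 pairs of kinds of visits, and for each of them
    and each element of [D] the sum over the two time indices is bounded by
    the tail estimate, the total length of the walks involved being at least
    [i + j]. *)
Lemma law_fails_prob n : (P (~` law_event n) <= clash_bound%:E)%E.
Proof.
pose past := [seq (j, i) | j <- enum 'I_4, i <- iota 0 n].
pose bad_step := \bigcup_(ji in [set` past]) x ji @^-1` [set u | u \notin S].
pose idx := [seq (qq, ij) | qq <- [seq (q, q') | q <- iota 0 4, q' <- iota 0 4],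
   ij <- [seq (i, j) | i <- iota 0 n, j <- iota 0 n]].
pose times (p : nat * nat * (nat * nat)) :=
  (visit_time n p.2.1 p.1.1, visit_time n p.2.2 p.1.2).
pose len p := ((times p).1.1 + (times p).1.2 + ((times p).2.1 + (times p).2.2))%N.
pose w p (e : 'rV[int]_5) : R := lattice_walks R (len p) e / 10 ^+ len p.
have [mx _ _] := iid.
have mclash e c c' : measurable (clash_event x e c c').
  by rewrite clash_eventE; apply: signed_sum_event_measurable iid _ _ _.
apply: (@le_trans _ _ (\sum_(pe <- [seq (p, e) | p <- idx, e <- D])
    P (clash_event x pe.2 (times pe.1).1 (times pe.1).2))%E).
  have mbad : measurable bad_step.
    by apply: fin_bigcup_measurable => // ji _; apply: mx.
  apply: (prob_le_sum (N := bad_step)) => //.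
  - exact/measurableC/law_event_measurable.
  - apply/eqP; rewrite eq_le measure_ge0 andbT.
    rewrite -[leRHS](_ :
        (\sum_(ji <- past) P (x ji @^-1` [set u | u \notin S]))%E = 0%E).
      apply: (prob_le_sum (N := set0)) => // [ji|t [ji jip xS]]; first exact: mx.
      by right; exists ji.
    by apply: big1 => ji _; apply: (step_in_as iid balS).
  move=> t nlaw; apply: contrapT => /not_orP[good noclash]; apply: nlaw.
  have stepS j i : (i < n)%N -> x (inord j, i) t \in S.
    move=> ni; apply/negPn/negP => xS; apply: good; exists (inord j, i) => //=.
    by apply: (allpairs_f (fun j i => (j, i))); rewrite ?mem_enum // mem_iota.
  apply: (metabelian_law_of_no_clash (d := d) clashS) => [i ni|i j c c' ni nj].
    by split; apply: stepS.
  move=> /(nthP (0, 0)%N)[q q4 <-] /(nthP (0, 0)%N)[q' q'4 <-].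
  apply/negP => eD; apply: noclash.
  exists (((q, q'), (i, j)),
    visit (fun i => x (inord 0, i)) (fun i => x (inord 1, i)) t
      (visit_time n i q)
    - visit (fun i => x (inord 2, i)) (fun i => x (inord 3, i)) t
        (visit_time n j q')).
    apply: (allpairs_f (fun p e => (p, e))) => //.
    apply: (allpairs_f (fun p e => (p, e))).
      by apply: (allpairs_f (fun p e => (p, e))); rewrite mem_iota.
    by apply: (allpairs_f (fun p e => (p, e))); rewrite mem_iota.
  by [].
apply: le_trans.
  by apply: lee_sum => pe _; apply: (clash_event_prob iid balS).
rewrite sumEFin lee_fin.
rewrite [leLHS](_ : _ = \sum_(e <- D) \sum_(p <- idx) w p e); last first.
  by rewrite exchange_big; apply: big_allpairs_dep.
have -> : clash_bound =
    (size D)%:R * (16%:R * (4 * Num.sqrt (10 ^+ 5) * rsqrt R K.+1)).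
  by rewrite /clash_bound natrM -mulrA mulrCA.
apply: sum_le_size => e eD.
pose qs := [seq (q, q') | q <- iota 0 4, q' <- iota 0 4].
rewrite [leLHS](_ : _ = \sum_(qq <- qs) \sum_(i < n) \sum_(j < n)
    w (qq, (i : nat, j : nat)) e).
  rewrite -[16%N]/(size qs); apply: sum_le_size => qq.
  move=> /allpairsP[[q q'] [q4 q'4 ->]].
  move: q4 q'4; rewrite !mem_iota /= => q4 q'4.
  apply: (@sum_far_walk_prob_le R K n (fun i j => len ((q, q'), (i, j)))).
    exact: farD.
  by move=> i j; apply: leq_add; apply: visit_time_ge.
transitivity (\sum_(qq <- qs)
    \sum_(ij <- [seq (i, j) | i <- iota 0 n, j <- iota 0 n]) w (qq, ij) e).
  exact: big_allpairs_dep.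
apply: eq_bigr => qq _.
transitivity (\sum_(i <- iota 0 n) \sum_(j <- iota 0 n) w (qq, (i, j)) e).
  exact: big_allpairs_dep.
rewrite -{1}(subn0 n) -/(index_iota 0 n) big_mkord; apply: eq_bigr => i _.
by rewrite -{1}(subn0 n) -/(index_iota 0 n) big_mkord.
Qed.

Lemma law_prob_ge n : ((1 - clash_bound)%:E <= P (law_event n))%E.
Proof.
have mL := law_event_measurable n.
rewrite -[law_event n]setCK probability_setC; last exact: measurableC.
by rewrite EFinB leeB // law_fails_prob.
Qed.

End LawProbability.

Lemma metabelian_with_prob_of_no_clash (R : realType) (H : groupType)
    (S : {fset wreath H 'rV[int]_5}) (D : seq 'rV[int]_5) (K : nat) :
  countable [set: wreath H 'rV[int]_5] -> balanced S -> clashes_in S D ->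
  (forall e, e \in D -> (K.+1 < `|e 0%R 0%R|)%N) ->
  metabelian_with_prob_ge S (1 - clash_bound D K : R).
Proof.
move=> cW balS clS farD d T P x iid /=.
by apply: limn_einf_ge => n; apply: (law_prob_ge iid balS cW clS farD).
Qed.

Lemma rsqrt_small (R : realType) (C eps : R) : 0 <= C -> 0 < eps ->
  exists K : nat, C * rsqrt R K.+1 <= eps.
Proof.
move=> C0 eps0; pose y := (C / eps) ^+ 2.
exists (Num.truncn y); set K := Num.truncn y.
have yK : y < K.+1%:R by apply: truncnS_gt.
rewrite /rsqrt ler_pdivrMr ?sqrtr_gt0 ?ltr0n // -ler_pdivrMl // mulrC.
rewrite -[leLHS]ger0_norm ?divr_ge0 ?(ltW eps0) // -sqrtr_sqr.
by rewrite ler_sqrt ?ltW // ltr0n.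
Qed.

Lemma metabelian_with_prob_le (R : realType) (G : groupType) (S : {fset G})
    (p q : R) :
  q <= p -> metabelian_with_prob_ge S p -> metabelian_with_prob_ge S q.
Proof.
move=> qp Sp d T P x iid; apply: le_trans (Sp _ _ _ _ iid).
by rewrite lee_fin.
Qed.

Local Close Scope ring_scope.
Local Close Scope classical_set_scope.

Theorem theorem6p3 (R : realType) (H : groupType) (a b : H)
    (Hnonabelian : ~ (forall x y : H, (x * y)%g = (y * x)%g))
    (Hgen : generates [set a; b]%classic)
    (eps : R) (eps_gt0 : (0 < eps)%R) :
  (exists S : {fset wreath H 'rV[int]_5},
     [/\ symmetric_fset S, generates [set` S]%classic, #|` S|%fset = 160
       & metabelian_with_prob_ge S (1 - eps)%R])
  /\
  (exists K : nat, forall k : nat, K <= k ->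
     let S := switch_move_switch a b k in
     [/\ symmetric_fset S,
         ~ odd_at_both a b -> generates [set` S]%classic,
         (a * a)%g <> 1%g -> (b * b)%g <> 1%g -> #|` S|%fset = 160
       & metabelian_with_prob_ge S (1 - eps)%R]).
Proof.
have nab : ~ commute a b.
  move=> ab; apply: Hnonabelian; apply: (generates_commute Hgen).
  by move=> x y [->|->] [->|->] //; apply: commute_sym.
have a1 : a <> 1%g by move=> a1; apply: nab; rewrite a1; apply/commute_sym/commute1.
have b1 : b <> 1%g by move=> b1; apply: nab; rewrite b1; apply: commute1.
have cW := wreath_countable Hgen.
(* Kept abstract, since the ring numeral M would otherwise be expanded in unary. *)
have [M ME] : exists M, M = (16 * ((14 + 14) * (11 * 11)))%N by eexists.
pose C : R := (M%:R * (4 * Num.sqrt (10 ^+ 5)))%R.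
have [K CK] : exists K : nat, (C * rsqrt R K.+1 <= eps)%R.
  by apply: rsqrt_small => //; rewrite /C !mulr_ge0 ?sqrtr_ge0.
(* 28 = 14 + 14 signed differences of sites, 121 = 11 * 11 offsets. In a clash
   the first coordinate falls short of k by at most 14 + 2, and it has to exceed
   K + 1. *)
have law k (S : {fset wreath H 'rV[int]_5}) : (K + 18 <= k)%N -> balanced S ->
    (forall s, s \in S -> switch_move a b 14 k s) ->
    metabelian_with_prob_ge S (1 - eps)%R.
  move=> Kk balS smS.
  apply: (metabelian_with_prob_le (p := (1 - clash_bound (clash_sites 14 k) K : R)%R)).
    rewrite lerD2l lerN2; apply: le_trans CK.
    by rewrite /clash_bound size_clash_sites -ME mulrA.
  apply: (metabelian_with_prob_of_no_clash cW balS) => [|e /clash_sites_coord].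
    exact: switch_move_clashes_in smS.
  by lia.
split.
  exists (spread_generators a b (K + 18)).
  split.
  - exact: spread_generators_symmetric.
  - exact: spread_generators_generate.
  - by apply: card_spread_generators => //; lia.
  - apply: (law (K + 18)%N) => //; first by apply: spread_generators_balanced => //; lia.
    exact: spread_generators_switch_move.
exists (K + 18)%N => k Kk S; have k1 : (1 < k)%N by lia.
split.
- exact: switch_move_switch_symmetric.
- by apply: switch_move_switch_generates => //; lia.
- by move=> aa bb; rewrite card_switch_move_switch // card_switches.
- apply: (law k) => //; first exact: switch_move_switch_balanced.
  by move=> s; apply: switch_move_switch_switch_move.
Qed.
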